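(* There is a universal constant $C_1$ such that for every positive integer $s$ and every $x\in\mathbb{R}$, $$\big|P(X_s \leq \mu+x\sigma) - \Phi(x)\big| \leq \frac{C_1}{\sqrt{s}},$$ where $X_s$ is the size of an $(s,s+1)$-core with distinct parts chosen uniformly at random, $\mu$ is the mean and $\sigma$ the standard deviation of $X_s$, and $\Phi$ is the standard normal distribution function.
   Context: A partition $\lambda=(\lambda_1\ge\lambda_2\ge\dots\ge\lambda_k>0)$ of $n$ has size $n=\sum\lambda_i$. In its Ferrers diagram, the hook length of a cell is the number of cells strictly to its right in its row, plus the number of cells strictly above it in its column, plus one. A partition is an $s$-core if no cell has hook length $s$, and an $(s,t)$-core if it is both an $s$-core and a $t$-core. A partition has distinct parts if $\lambda_1>\lambda_2>\dots>\lambda_k$. For each positive integer $s$ there are finitely many $(s,s+1)$-cores with distinct parts, and $X_s$ is the size of one chosen uniformly among them. *)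

(* Defs.v *)
From Stdlib Require Import Reals.
From Coquelicot Require Import Coquelicot.
From mathcomp Require Import all_boot.

Local Open Scope nat_scope.
Set Implicit Arguments.
Unset Strict Implicit.
Unset Printing Implicit Defensive.

Definition is_partition (l : seq nat) : Prop :=
  sorted (fun a b : nat => (b <= a)%N) l /\ all (fun a : nat => (0 < a)%N) l.

Definition distinct_parts (l : seq nat) : Prop :=
  sorted (fun a b : nat => (b < a)%N) l.

Definition psize (l : seq nat) : nat := sumn l.

(* Cells are (i, j) with i < size l (row, 0-based) and j < l_i (column, 0-based).
   Hook length = (cells strictly right in the row: l_i - j - 1)
               + (cells in the same column in the other rows of the diagram
                  beyond row i, i.e. rows i' > i with l_{i'} > j) + 1. *)
Definition hook (l : seq nat) (i j : nat) : nat :=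
  (nth 0 l i - j - 1) + count (fun a : nat => (j < a)%N) (drop i.+1 l) + 1.

Definition is_core (t : nat) (l : seq nat) : Prop :=
  forall i j, i < size (l) -> j < nth 0 l i -> hook l i j <> t.

Definition core_distinct (s : nat) (l : seq nat) : Prop :=
  is_partition l /\ distinct_parts l /\ is_core s l /\ is_core s.+1 l.

Local Open Scope R_scope.

(* Uniform distribution on a finite (duplicate-free) list L of partitions;
   X = size of the chosen partition. *)
Definition unif_mean (L : seq (seq nat)) : R :=
  (\big[Rplus/0]_(p <- L) INR (psize p)) / INR (size L).

Definition unif_var (L : seq (seq nat)) : R :=
  (\big[Rplus/0]_(p <- L) (INR (psize p) - unif_mean L) ^ 2) / INR (size L).

Definition unif_sd (L : seq (seq nat)) : R := sqrt (unif_var L).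

Definition unif_cdf (L : seq (seq nat)) (y : R) : R :=
  INR (count (fun p => if Rle_dec (INR (psize p)) y then true else false) L) / INR (size L).

Definition Phi (x : R) : R :=
  RInt_gen (fun t => exp (- t ^ 2 / 2) / sqrt (2 * PI))
           (Rbar_locally m_infty) (at_point x).

(* Main.v *)
Require Import Defs.
From Stdlib Require Import Reals Lra.
From Coquelicot Require Import Coquelicot.
From mathcomp Require Import all_boot.

(** A partition with distinct parts is an [(s, s+1)]-core exactly when its
    largest part plus its number of parts is at most [s].  Hence a core with [k]
    parts is a [k]-subset of [{1, ..., s - k}], its size [X] is the sum of the
    subset, and the mean of [X] given [k] is [mu_k = k (s - k + 1) / 2].

    The error is bounded by Stein's method, with two families of moves on
    subsets.  Swapping an element with a non-element gives, for fixed [k],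
    [E ((X - mu_k) f(X)) = E (1 / (2 (s - k)) sum (y - x) (f(X + y - x) - f(X)))].
    Turning a non-element into an element and deleting another non-element from
    the ground set changes [k] into [k + 1], and every [(k + 1)]-subset is reached
    [(k + 1) (s - k)] times.  This gives
    [E ((10 mu_k - 6 k - s^2 + s) f(X)) = E (sum (f(X') - f(X)))],
    where the factor on the left is, up to the small term [6 k], an affine
    function of [mu_k].  Adding the two identities yields a Stein identity for [X]
    whose increments are at most [s], against a standard deviation of order
    [s^(3/2)].  Its conditional variance is a polynomial in [k], [X] and the sum of
    the squares of the elements; all three concentrate, again by the same moves,
    and so does [X] itself at scale [s], by the swap identity for a truncated
    linear [f]. *)

(** * The Gaussian integral and the standard normal distribution function *)

Section Gaussian.
Local Open Scope R_scope.

Definition bell (t : R) : R := exp (- t ^ 2 / 2).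

Definition bell_primitive (x : R) : R := RInt bell 0 x.

Lemma continuous_bell (x : R) : continuous bell x.
Proof.
apply: ex_derive_continuous; rewrite /bell; auto_derive; exact I.
Qed.

Lemma is_derive_bell_primitive (x : R) : is_derive bell_primitive x (bell x).
Proof.
apply: (@is_derive_RInt _ bell bell_primitive 0 x); last exact: continuous_bell.
apply: filter_forall => y; apply: RInt_correct; apply: ex_RInt_continuous.
by move=> z _; exact: continuous_bell.
Qed.

Lemma bell_pos (x : R) : 0 < bell x.
Proof. exact: exp_pos. Qed.

Lemma bell_opp (x : R) : bell (- x) = bell x.
Proof. by rewrite /bell; congr exp; field. Qed.

(* Half of the square of [bell_primitive] plus this integral is constant, which
   evaluates the Gaussian integral by letting [x] go from [0] to infinity. *)
Definition polar_integral (x : R) : R :=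
  RInt (fun t => exp (- x ^ 2 * (1 + t ^ 2) / 2) / (1 + t ^ 2)) 0 1.

Lemma one_plus_sqr_neq0 (t : R) : 1 + t ^ 2 <> 0.
Proof. by have := pow2_ge_0 t; lra. Qed.

Lemma continuous_polar (x t : R) :
  continuous (fun t => exp (- x ^ 2 * (1 + t ^ 2) / 2) / (1 + t ^ 2)) t.
Proof.
apply: ex_derive_continuous; auto_derive; exact: one_plus_sqr_neq0.
Qed.

Lemma continuity_2d_pt_exp (f : R -> R -> R) (x y : R) :
  continuity_2d_pt f x y -> continuity_2d_pt (fun u v => exp (f u v)) x y.
Proof.
move=> cf; apply: (continuity_1d_2d_pt_comp exp f) => //.
exact: derivable_continuous_pt (derivable_pt_exp _).
Qed.

(** Differentiating under the integral sign cancels the denominator [1 + t ^ 2]; the factor [bell x]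
    then splits off, and the substitution [u = x * t] turns the rest into [bell_primitive x]. *)
Lemma is_derive_polar_integral (x : R) :
  is_derive polar_integral x (- bell x * bell_primitive x).
Proof.
have der u t : is_derive (fun u => exp (- u ^ 2 * (1 + t ^ 2) / 2) / (1 + t ^ 2))
    u (- u * exp (- u ^ 2 * (1 + t ^ 2) / 2)).
  have nz := one_plus_sqr_neq0 t.
  auto_derive => //=; rewrite /Rdiv /=; field; by move: nz; rewrite /= Rmult_1_r.
have -> : - bell x * bell_primitive x =
    RInt (fun t => Derive (fun u =>
      exp (- u ^ 2 * (1 + t ^ 2) / 2) / (1 + t ^ 2)) x) 0 1.
  have -> : bell_primitive x = RInt (fun t => x * bell (x * t + 0)) 0 1.
    rewrite RInt_comp_lin /bell_primitive; last first.
      by apply: ex_RInt_continuous => z _; exact: continuous_bell.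
    by congr RInt; ring.
  symmetry; apply: is_RInt_unique.
  apply: (is_RInt_ext (fun t => scal (- bell x) (x * bell (x * t + 0)))); last first.
    apply: is_RInt_scal; apply: RInt_correct.
    apply: ex_RInt_continuous => z _; apply: ex_derive_continuous.
    rewrite /bell; auto_derive; exact: I.
  move=> t _; rewrite (is_derive_unique _ _ _ (der x t)).
  rewrite /scal /= /mult /= /bell.
  have -> : - (x * (x * 1)) * (1 + t * (t * 1)) / 2 =
    - (x * (x * 1)) / 2 + - ((x * t + 0) * ((x * t + 0) * 1)) / 2 by field.
  rewrite exp_plus /=; ring.
apply: (is_derive_RInt_param
  (fun x t => exp (- x ^ 2 * (1 + t ^ 2) / 2) / (1 + t ^ 2)) 0 1 x).
- by apply: filter_forall => u t _; eexists; exact: der.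
- move=> t _; apply: (continuity_2d_pt_ext
    (fun u v => (- u) * exp ((- u * u) * (1 + v * v) / 2))).
    move=> u v; rewrite (is_derive_unique _ _ _ (der u v)).
    by congr (_ * exp _); field.
  have cid := continuity_2d_pt_id1 x t; have cid2 := continuity_2d_pt_id2 x t.
  have cN := continuity_2d_pt_opp _ _ _ cid.
  apply: continuity_2d_pt_mult => //; apply: continuity_2d_pt_exp.
  apply: continuity_2d_pt_mult; last exact: continuity_2d_pt_const.
  apply: continuity_2d_pt_mult; first exact: continuity_2d_pt_mult.
  apply: continuity_2d_pt_plus; first exact: continuity_2d_pt_const.
  exact: continuity_2d_pt_mult.
- apply: filter_forall => u; apply: ex_RInt_continuous => t _.
  exact: continuous_polar.
Qed.

Lemma polar_integral0 : polar_integral 0 = PI / 4.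
Proof.
rewrite /polar_integral -atan_1.
have -> : atan 1 = minus (atan 1) (atan 0) by rewrite /minus /plus /opp /= atan_0; ring.
apply: is_RInt_unique; apply: (is_RInt_ext (fun t => / (1 + t²))).
  move=> t _; rewrite /Rsqr; have -> : - 0 ^ 2 * (1 + t ^ 2) / 2 = 0 by field.
  by rewrite exp_0 /=; field; have := one_plus_sqr_neq0 t; rewrite /= Rmult_1_r.
apply: is_RInt_derive => t _; first exact: is_derive_atan.
apply: ex_derive_continuous; rewrite /Rsqr; auto_derive.
by have := one_plus_sqr_neq0 t; rewrite /= Rmult_1_r.
Qed.

Lemma polar_integral_bounds (x : R) : 0 <= polar_integral x <= bell x.
Proof.
have ex := ex_RInt_continuous _ 0 1 (fun t _ => continuous_polar x t).
have h t : 0 < / (1 + t ^ 2) <= 1.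
  have := pow2_ge_0 t => h; split; first by apply: Rinv_0_lt_compat; lra.
  by rewrite -[X in _ <= X]Rinv_1; apply: Rinv_le_contravar; lra.
split.
  apply: RInt_ge_0 => //; first lra.
  move=> t _; apply: Rmult_le_pos; first by left; exact: exp_pos.
  by case: (h t); lra.
have -> : bell x = RInt (fun _ => bell x) 0 1.
  by rewrite RInt_const /scal /= /mult /=; ring.
apply: RInt_le => //; first lra; first exact: ex_RInt_const.
move=> t _; case: (h t) => h1 h2; rewrite -[bell x]Rmult_1_r.
apply: Rmult_le_compat => //; [by left; exact: exp_pos | lra | ].
have : - x ^ 2 * (1 + t ^ 2) / 2 <= - x ^ 2 / 2.
  have := pow2_ge_0 (x * t); rewrite Rpow_mult_distr; lra.
by case=> [?|->]; [left; exact: exp_increasing | right].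
Qed.

Lemma bell_primitive0 : bell_primitive 0 = 0.
Proof. by rewrite /bell_primitive RInt_point. Qed.

Lemma derive_zero_const (f : R -> R) :
  (forall x, is_derive f x 0) -> forall x, f x = f 0.
Proof.
move=> df x.
have [c [_]] := MVT_gen f 0 x (fun _ => 0) (fun y _ => df y)
  (fun y _ => derivable_continuous_pt _ _ (ex_derive_Reals_0 _ _ (ex_intro _ _ (df y)))).
lra.
Qed.

Lemma bell_primitive_sqr (x : R) :
  bell_primitive x ^ 2 = PI / 2 - 2 * polar_integral x.
Proof.
have := derive_zero_const (fun x => bell_primitive x ^ 2 + 2 * polar_integral x).
move=> /(_ _ x) H; have {H} := H _.
rewrite bell_primitive0 polar_integral0 => H; rewrite -[LHS](Rplus_0_r _).
suff : bell_primitive x ^ 2 + 2 * polar_integral x = 0 ^ 2 + 2 * (PI / 4) by lra.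
apply: H => y.
have d1 := is_derive_bell_primitive y; have d2 := is_derive_polar_integral y.
auto_derive; first by split; [eexists; exact: d1 | split=> //; eexists; exact: d2].
rewrite (is_derive_unique _ _ _ d1) (is_derive_unique _ _ _ d2); ring.
Qed.

Lemma bell_primitive_opp (x : R) : bell_primitive (- x) = - bell_primitive x.
Proof.
suff : bell_primitive x + bell_primitive (- x) = 0 by lra.
have := derive_zero_const (fun x => bell_primitive x + bell_primitive (- x)).
move=> /(_ _ x) ->; first by rewrite Ropp_0 bell_primitive0; ring.
move=> y; have d1 := is_derive_bell_primitive y.
have d2 := is_derive_bell_primitive (- y).
auto_derive; first by split; [eexists; exact: d1 | split=> //; eexists; exact: d2].
rewrite (is_derive_unique _ _ _ d1) (is_derive_unique _ _ _ d2) bell_opp; ring.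
Qed.

Lemma nonneg_derive_incr (f df : R -> R) (a b : R) :
  a <= b -> (forall x, a <= x <= b -> is_derive f x (df x)) ->
  (forall x, a <= x <= b -> 0 <= df x) -> f a <= f b.
Proof.
move=> ab der pos.
have [c [ci e]] : exists c, Rmin a b <= c <= Rmax a b /\ f b - f a = df c * (b - a).
  apply: (MVT_gen f a b df).
    by move=> x; rewrite Rmin_left // Rmax_right // => ?; apply: der; lra.
  move=> x; rewrite Rmin_left // Rmax_right // => ?.
  apply: derivable_continuous_pt; apply: ex_derive_Reals_0.
  by eexists; apply: der; lra.
move: ci; rewrite Rmin_left // Rmax_right // => ci.
have := Rmult_le_pos (df c) (b - a) (pos _ ci); lra.
Qed.

Lemma bell_small (x : R) : bell x <= 2 / (2 + x ^ 2).
Proof.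
have x2 := pow2_ge_0 x.
have -> : 2 / (2 + x ^ 2) = / (1 + x ^ 2 / 2) by field; lra.
have -> : bell x = / exp (x ^ 2 / 2).
  by rewrite -exp_Ropp /bell; congr exp; field.
apply: Rinv_le_contravar; first lra.
by have := exp_ineq1_le (x ^ 2 / 2); lra.
Qed.

Lemma is_lim_bell : is_lim bell m_infty 0.
Proof.
apply: (is_lim_le_le_loc (fun _ => 0) (fun x => 2 * / - x)); last first.
- have -> : Rbar.Finite 0 = Rbar_mult 2 (Rbar_inv p_infty) by rewrite /= Rmult_0_r.
  apply: is_lim_scal_l; apply: is_lim_inv => //.
  exact: (is_lim_opp (fun y => y) m_infty m_infty (is_lim_id _)).
- exact: is_lim_const.
exists (- 1) => x x1; split; first by left; exact: bell_pos.
apply: Rle_trans (bell_small x) _; apply: Rmult_le_compat_l; first lra.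
by apply: Rinv_le_contravar; [lra | nra].
Qed.

Lemma bell_primitive_neg (x : R) : x <= 0 -> bell_primitive x <= 0.
Proof.
move=> x0; rewrite -bell_primitive0.
apply: (nonneg_derive_incr bell_primitive bell) => // y _.
  exact: is_derive_bell_primitive.
by left; exact: bell_pos.
Qed.

Lemma is_lim_bell_primitive :
  is_lim bell_primitive m_infty (- sqrt (PI / 2)).
Proof.
apply: (is_lim_ext_loc (fun x => - sqrt (PI / 2 - 2 * polar_integral x))).
  (* Left of 0 the primitive is nonpositive, so it is the negative root of its square. *)
  exists 0 => x x0; rewrite -bell_primitive_sqr.
  rewrite -Rsqr_pow2 sqrt_Rsqr_abs Rabs_left1; first ring.
  by apply: bell_primitive_neg; lra.
have lim : is_lim polar_integral m_infty 0.
  apply: (is_lim_le_le_loc (fun _ => 0) bell).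
  - by exists 0 => x _; exact: polar_integral_bounds.
  - exact: is_lim_const.
  - exact: is_lim_bell.
apply: (is_lim_opp _ _ (Rbar.Finite _)).
have cs : continuous sqrt (PI / 2) by exact: continuous_sqrt.
have lim2 : is_lim (fun x => PI / 2 - 2 * polar_integral x) m_infty (PI / 2).
  have -> : Rbar.Finite (PI / 2) = Rbar.Finite (PI / 2 - 2 * 0) by congr Rbar.Finite; ring.
  apply: (is_lim_minus' _ _ _ (PI / 2) (2 * 0)); first exact: is_lim_const.
  exact: (is_lim_scal_l _ 2 m_infty 0).
exact: (filterlim_comp _ _ _ _ sqrt _ _ _ lim2 cs).
Qed.

Lemma sqrt_2PI : sqrt (2 * PI) = 2 * sqrt (PI / 2).
Proof.
have -> : 2 * PI = 2 ^ 2 * (PI / 2) by field.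
rewrite sqrt_mult; [rewrite sqrt_pow2 //; lra | nra | ].
by have := PI_RGT_0; lra.
Qed.

Lemma sqrt_2PI_bounds : 2 < sqrt (2 * PI) < 3.
Proof.
have [P4 P3] : PI <= 4 /\ 3 / 2 < PI / 2 by split; [exact: PI_4 | exact: PI2_3_2].
split; [rewrite -{1}(sqrt_pow2 2); last lra | rewrite -(sqrt_pow2 3); last lra].
  by apply: sqrt_lt_1; lra.
by apply: sqrt_lt_1; lra.
Qed.

(** The improper integral is the antiderivative [F] at [x] minus its limit at minus infinity; this
    limit is [- (1 / 2)], because [sqrt (2 * PI)] is twice [sqrt (PI / 2)]. *)
Lemma Phi_bell_primitive (x : R) :
  Phi x = 1 / 2 + bell_primitive x / sqrt (2 * PI).
Proof.
have [q0 _] := sqrt_2PI_bounds.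
pose F y := bell_primitive y / sqrt (2 * PI).
have dF y : is_derive F y (bell y / sqrt (2 * PI)).
  have d := is_derive_bell_primitive y; rewrite /F; auto_derive.
    by exists (bell y).
  by rewrite (is_derive_unique _ _ _ d) /Rdiv; ring.
have -> : 1 / 2 + bell_primitive x / sqrt (2 * PI) = F x - (- (1 / 2)) by rewrite /F; ring.
refine (is_RInt_gen_unique (V := R_CompleteNormedModule) _ _ _).
apply: (is_RInt_gen_ext (V := R_NormedModule) (Derive F)).
  by apply: filter_forall => -[a b] /= y _; apply: is_derive_unique; exact: dF.
apply: is_RInt_gen_Derive.
- by apply: filter_forall => -[a b] /= y _; eexists; exact: dF.
- apply: filter_forall => -[a b] /= y _.
  apply: (continuous_ext (fun y => bell y / sqrt (2 * PI))).
    by move=> u; symmetry; apply: is_derive_unique; exact: dF.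
  apply: ex_derive_continuous; rewrite /bell; auto_derive; exact: I.
- have -> : - (1 / 2) = / sqrt (2 * PI) * (- sqrt (PI / 2)).
    by move: q0; rewrite sqrt_2PI => q0; field; lra.
  apply: (is_lim_ext (fun y => / sqrt (2 * PI) * bell_primitive y) F m_infty (Rbar.Finite _)).
    by move=> y; rewrite /F; field; lra.
  exact: (is_lim_scal_l _ _ m_infty (Rbar.Finite _) is_lim_bell_primitive).
- move=> P [eps HP]; apply: HP; exact: ball_center.
Qed.

Definition phi (x : R) : R := bell x / sqrt (2 * PI).

Lemma phi_pos (x : R) : 0 < phi x.
Proof.
have [q _] := sqrt_2PI_bounds.
by apply: Rdiv_lt_0_compat; [exact: bell_pos | lra].
Qed.

Lemma is_derive_Phi (x : R) : is_derive Phi x (phi x).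
Proof.
apply: (is_derive_ext (fun x => 1 / 2 + bell_primitive x / sqrt (2 * PI))).
  by move=> y; rewrite Phi_bell_primitive.
have d := is_derive_bell_primitive x; auto_derive; first by eexists; exact: d.
by rewrite (is_derive_unique _ _ _ d) /phi /Rdiv; ring.
Qed.

Lemma is_lim_Phi : is_lim Phi m_infty 0.
Proof.
have [q _] := sqrt_2PI_bounds.
apply: (is_lim_ext (fun x => 1 / 2 + / sqrt (2 * PI) * bell_primitive x)).
  by move=> y; rewrite Phi_bell_primitive; field; lra.
have -> : Rbar.Finite 0 = Rbar.Finite (1 / 2 + / sqrt (2 * PI) * - sqrt (PI / 2)).
  by congr Rbar.Finite; move: q; rewrite sqrt_2PI => q; field; lra.
apply: (is_lim_plus' _ _ _ (1 / 2)); first exact: is_lim_const.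
exact: (is_lim_scal_l _ _ m_infty (Rbar.Finite _) is_lim_bell_primitive).
Qed.

Lemma Phi_opp (x : R) : Phi (- x) = 1 - Phi x.
Proof. by rewrite !Phi_bell_primitive bell_primitive_opp; field; have := sqrt_2PI_bounds; lra. Qed.

Lemma Phi_incr (x y : R) : x <= y -> Phi x <= Phi y.
Proof.
move=> xy; apply: (nonneg_derive_incr Phi phi) => // z _; first exact: is_derive_Phi.
by left; exact: phi_pos.
Qed.

Lemma Phi_ge0 (x : R) : 0 <= Phi x.
Proof.
apply: (is_lim_le_loc Phi (fun _ => Phi x) m_infty 0 (Phi x)).
- by exists x => y yx; apply: Phi_incr; lra.
- exact: is_lim_Phi.
- exact: is_lim_const.
Qed.

Lemma Phi_le1 (x : R) : Phi x <= 1.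
Proof. by have := Phi_ge0 (- x); rewrite Phi_opp; lra. Qed.

Lemma is_derive_phi (x : R) : is_derive phi x (- x * phi x).
Proof.
have [q _] := sqrt_2PI_bounds.
rewrite /phi /bell; auto_derive => //=; rewrite /Rdiv; field; lra.
Qed.

Lemma is_lim_phi : is_lim phi m_infty 0.
Proof.
have -> : Rbar.Finite 0 = Rbar_mult 0 (/ sqrt (2 * PI)) by rewrite /= Rmult_0_l.
apply: is_lim_scal_r; exact: is_lim_bell.
Qed.

(** The function [phi a + w * Phi a] of [a] tends to 0 at minus infinity, and its derivative
    [(w - a) * phi a] is nonnegative for [a <= w]. *)
Lemma Phi_tail (w : R) : w < 0 -> - w * Phi w <= phi w.
Proof.
move=> w0.
suff : 0 <= phi w - - w * Phi w by lra.
apply: (is_lim_le_loc (fun a => phi a - - w * Phi a)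
  (fun _ => phi w - - w * Phi w) m_infty 0 (phi w - - w * Phi w)).
- exists w => a aw.
  apply: (nonneg_derive_incr (fun a => phi a - - w * Phi a)
    (fun a => (w - a) * phi a)); first lra.
    move=> x _; have d1 := is_derive_phi x; have d2 := is_derive_Phi x.
    auto_derive; first by split; [eexists; exact: d1 | split=> //; eexists; exact: d2].
    by rewrite (is_derive_unique _ _ _ d1) (is_derive_unique _ _ _ d2); ring.
  move=> x ?; apply: Rmult_le_pos; first lra.
  by left; exact: phi_pos.
- have -> : Rbar.Finite 0 = Rbar.Finite (0 - - w * 0) by congr Rbar.Finite; ring.
  apply: (is_lim_minus' _ _ _ 0 (- w * 0)); first exact: is_lim_phi.
  exact: (is_lim_scal_l _ _ m_infty 0 is_lim_Phi).
- exact: is_lim_const.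
Qed.

(** * The Mills ratio and the solution of the Stein equation *)

Definition mills (w : R) : R := Phi w / phi w.

Lemma is_derive_mills (w : R) : is_derive mills w (1 + w * mills w).
Proof.
have d1 := is_derive_phi w; have d2 := is_derive_Phi w; have p := phi_pos w.
rewrite /mills; auto_derive.
  by split; [eexists; exact: d2 | split; [eexists; exact: d1 | split=> //; lra]].
by rewrite (is_derive_unique _ _ _ d1) (is_derive_unique _ _ _ d2); field; lra.
Qed.

Lemma mills_ge0 (w : R) : 0 <= mills w.
Proof.
apply: Rmult_le_pos (Phi_ge0 w) _.
by left; apply: Rinv_0_lt_compat; exact: phi_pos.
Qed.

Lemma mills_tail (w : R) : w <= 0 -> - w * mills w <= 1.
Proof.
case=> [w0 | ->]; last lra.
have p := phi_pos w.
have -> : 1 = phi w * / phi w by field; lra.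
have -> : - w * mills w = (- w * Phi w) * / phi w by rewrite /mills; field; lra.
apply: Rmult_le_compat_r; last exact: Phi_tail.
by left; exact: Rinv_0_lt_compat.
Qed.

(** By [mills_tail] the derivative [1 + w * mills w] is nonnegative here, so the maximum is
    [mills 0], at most [sqrt (2 * PI) < 3]. *)
Lemma mills_le3 (w : R) : w <= 0 -> mills w <= 3.
Proof.
move=> w0; apply: (Rle_trans _ (mills 0)).
  apply: (nonneg_derive_incr mills (fun w => 1 + w * mills w)) => // x ?.
    exact: is_derive_mills.
  by have := mills_tail x; lra.
have [q0 q3] := sqrt_2PI_bounds.
have -> : mills 0 = Phi 0 * sqrt (2 * PI).
  rewrite /mills /phi /bell; have -> : - 0 ^ 2 / 2 = 0 by field.
  by rewrite exp_0; field; lra.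
by have := Phi_le1 0; have := Phi_ge0 0; nra.
Qed.

Definition stein_left (z w : R) : R := mills w * (1 - Phi z).

(** The bounded solution of the Stein equation, whose right-hand side is the indicator of [w <= z]
    minus [Phi z]. The branch right of [z] is the reflection of the left one, so estimates are
    proved for [stein_left] only. *)
Definition stein (z w : R) : R :=
  if Rle_dec w z then stein_left z w else stein_left (- z) (- w).

(** The derivative as prescribed by the Stein equation. The solution has a corner at [z], where this
    is the derivative from the left. *)
Definition stein_deriv (z w : R) : R :=
  w * stein z w + (if Rle_dec w z then 1 else 0) - Phi z.

(** Both sides are [Phi w * Phi (- w) / phi w]. The symmetry makes the two branches of [stein] meet
    at [z] and carries Mills bounds over to positive arguments. *)
Lemma mills_Phi_opp (w : R) : mills w * (1 - Phi w) = mills (- w) * Phi w.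
Proof.
have p := phi_pos w.
have ep : phi (- w) = phi w by rewrite /phi bell_opp.
by rewrite /mills ep Phi_opp; field; lra.
Qed.

Lemma stein_left_bounds (z w : R) : w <= z ->
  0 <= stein_left z w <= 3 /\ Rabs (w * stein_left z w) <= 1.
Proof.
move=> wz; rewrite /stein_left.
have z0 := Phi_ge0 z; have z1 := Phi_le1 z; have m0 := mills_ge0 w.
have w0 := Phi_ge0 w; have w1 := Phi_le1 w; have m0' := mills_ge0 (- w).
case: (Rle_dec w 0) => hw.
  have m3 := mills_le3 w hw; have mt := mills_tail w hw.
  split; first by nra.
  rewrite Rabs_left1; last by have := Rmult_le_pos _ (1 - Phi z) m0; nra.
  by have := Rmult_le_pos (1 - - w * mills w) (1 - Phi z); nra.
have m3 : mills (- w) <= 3 by apply: mills_le3; lra.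
have mt : w * mills (- w) <= 1 by have := mills_tail (- w); rewrite Ropp_involutive; lra.
(* For [w > 0] the ratio [mills w] is unbounded; as [w <= z], the factor [1 - Phi z] is at most
   [1 - Phi w], which compensates for it. *)
have le : mills w * (1 - Phi z) <= mills (- w).
  apply: (Rle_trans _ (mills w * (1 - Phi w))).
    by apply: Rmult_le_compat_l => //; have := Phi_incr w z wz; lra.
  by rewrite mills_Phi_opp; nra.
have ge : 0 <= mills w * (1 - Phi z) by apply: Rmult_le_pos => //; lra.
by split; [lra | rewrite Rabs_right; nra].
Qed.

Lemma is_derive_stein_left (z w : R) :
  is_derive (stein_left z) w (w * stein_left z w + 1 - Phi z).
Proof.
have d := is_derive_mills w; rewrite /stein_left; auto_derive.
  by eexists; exact: d.
by rewrite (is_derive_unique _ _ _ d); ring.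
Qed.

Lemma stein_left_mvt (z a b : R) : a <= z -> b <= z ->
  exists c, [/\ c <= z, Rabs (c - a) <= Rabs (b - a) &
    stein_left z b - stein_left z a = (c * stein_left z c + 1 - Phi z) * (b - a)].
Proof.
move=> az bz.
have [c [ci e]] := MVT_gen (stein_left z) a b
  (fun w => w * stein_left z w + 1 - Phi z)
  (fun w _ => is_derive_stein_left z w)
  (fun w _ => derivable_continuous_pt _ _
     (ex_derive_Reals_0 _ _ (ex_intro _ _ (is_derive_stein_left z w)))).
exists c; split => //; move: ci; rewrite /Rmin /Rmax; case: Rle_dec => h ci; try lra.
  by rewrite !Rabs_right; lra.
by rewrite !Rabs_left1; lra.
Qed.

Lemma stein_left_lipschitz (z a b : R) : a <= z -> b <= z ->
  Rabs (stein_left z b - stein_left z a) <= 2 * Rabs (b - a).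
Proof.
move=> az bz; have [c [cz _ ->]] := stein_left_mvt z a b az bz.
rewrite Rabs_mult; apply: Rmult_le_compat_r; first exact: Rabs_pos.
have [_ /Rabs_le_between ?] := stein_left_bounds z c cz.
by have z0 := Phi_ge0 z; have z1 := Phi_le1 z; apply: Rabs_le; lra.
Qed.

(** The equation expresses the derivative through the function itself, so the increment of the
    derivative is controlled by the bound 3 and the Lipschitz constant 2 of the function; hence
    [3 + 2 * Rabs a]. *)
Lemma stein_left_taylor (z a b : R) : a <= z -> b <= z ->
  Rabs (stein_left z b - stein_left z a
        - (b - a) * (a * stein_left z a + 1 - Phi z))
  <= Rabs (b - a) * (Rabs (b - a) * (3 + 2 * Rabs a)).
Proof.
move=> az bz; have [c [cz ca ->]] := stein_left_mvt z a b az bz.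
set fc := stein_left z c; set fa := stein_left z a.
have -> : (c * fc + 1 - Phi z) * (b - a) - (b - a) * (a * fa + 1 - Phi z)
  = (b - a) * ((c - a) * fc + a * (fc - fa)) by ring.
rewrite Rabs_mult; apply: Rmult_le_compat_l; first exact: Rabs_pos.
apply: Rle_trans (Rabs_triang _ _) _; rewrite (Rabs_mult (c - a)) (Rabs_mult a).
have [[fc0 fc3] _] := stein_left_bounds z c cz.
have l := stein_left_lipschitz z a c az cz; rewrite -/fc -/fa in l fc0 fc3.
rewrite (Rabs_right fc); last lra.
have := Rabs_pos a; have := Rabs_pos (c - a); have := Rabs_pos (fc - fa); nra.
Qed.

Lemma stein_right (z w : R) : z <= w -> stein z w = stein_left (- z) (- w).
Proof.
rewrite /stein; case: Rle_dec => //= wz zw; have -> : w = z by lra.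
by rewrite /stein_left mills_Phi_opp Phi_opp; ring.
Qed.

Lemma stein_leftE (z w : R) : w <= z -> stein z w = stein_left z w.
Proof. by rewrite /stein; case: Rle_dec. Qed.

Lemma stein_bounds (z w : R) :
  Rabs (stein z w) <= 3 /\ Rabs (stein_deriv z w) <= 2.
Proof.
have z0 := Phi_ge0 z; have z1 := Phi_le1 z.
rewrite /stein_deriv; case: (Rle_dec w z) => [wz | zw] /=.
  rewrite stein_leftE //; have [? /Rabs_le_between ?] := stein_left_bounds z w wz.
  by split; [rewrite Rabs_right; lra | apply: Rabs_le; lra].
rewrite stein_right; last lra.
have [? /Rabs_le_between ?] : 0 <= stein_left (- z) (- w) <= 3 /\
    Rabs (- w * stein_left (- z) (- w)) <= 1 by apply: stein_left_bounds; lra.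
by split; [rewrite Rabs_right; lra | apply: Rabs_le; lra].
Qed.

Lemma stein_lipschitz (z w d : R) :
  Rabs (stein z (w + d) - stein z w) <= 2 * Rabs d.
Proof.
suff lip a b : a <= b -> Rabs (stein z b - stein z a) <= 2 * (b - a).
  case: (Rle_dec 0 d) => hd.
    by rewrite (Rabs_right d); [have := lip w (w + d); lra | lra].
  by rewrite (Rabs_left d) 1?Rabs_minus_sym; [have := lip (w + d) w; lra | lra].
have left a' b' : a' <= b' -> b' <= z -> Rabs (stein z b' - stein z a') <= 2 * (b' - a').
  move=> ab bz; rewrite !stein_leftE; try lra.
  apply: Rle_trans (stein_left_lipschitz z a' b' _ bz) _; first lra.
  by rewrite Rabs_right; lra.
have right a' b' : a' <= b' -> z <= a' -> Rabs (stein z b' - stein z a') <= 2 * (b' - a').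
  move=> ab za; rewrite !stein_right; try lra.
  apply: Rle_trans (stein_left_lipschitz (- z) (- a') (- b') _ _) _; try lra.
  by rewrite Rabs_left1; lra.
move=> ab; case: (Rle_dec b z) => bz; first exact: left.
case: (Rle_dec z a) => za; first exact: right.
have -> : stein z b - stein z a = (stein z b - stein z z) + (stein z z - stein z a) by ring.
apply: Rle_trans (Rabs_triang _ _) _.
have := left a z; have := right z b; lra.
Qed.

(** The two hypotheses keep [w] and [w + d] on the same side of the corner. *)
Lemma stein_taylor (z w d e : R) : Rabs d <= e -> e < Rabs (w - z) ->
  Rabs (stein z (w + d) - stein z w - d * stein_deriv z w)
  <= Rabs d * (e * (3 + 2 * Rabs w)).
Proof.
move=> de ez; apply: (Rle_trans _ (Rabs d * (Rabs d * (3 + 2 * Rabs w)))); last first.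
  apply: Rmult_le_compat_l (Rabs_pos _) _; apply: Rmult_le_compat_r => //.
  by have := Rabs_pos w; lra.
have /Rabs_le_between dd := de; rewrite /stein_deriv.
case: (Rle_dec w z) => wz /=.
  have zd : w + d <= z by move: ez; rewrite Rabs_left1; lra.
  have := stein_left_taylor z w (w + d) wz zd.
  have -> : w + d - w = d by ring.
  by rewrite !stein_leftE //; congr (Rabs _ <= _).
have zd : z <= w + d by move: ez; rewrite Rabs_right; lra.
have := stein_left_taylor (- z) (- w) (- (w + d)).
rewrite !stein_right //; try lra.
have -> : - (w + d) - - w = - d by ring.
rewrite !Rabs_Ropp Phi_opp => h; apply: Rle_trans (h _ _); try lra.
by right; congr (Rabs _); ring.
Qed.

End Gaussian.

From mathcomp Require Import all_order all_algebra ring lra zify Rstruct.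
Import Order.TTheory GRing.Theory Num.Theory.

Set Implicit Arguments.
Unset Strict Implicit.
Unset Printing Implicit Defensive.

(** * Exchange and counting identities for subsets of a finite ground set *)

Section Moves.
Local Open Scope ring_scope.
Variable R : realFieldType.

(* Elements of ['I_m] are counted from 0, whereas parts are at least 1. *)
Definition ssum m (A : {set 'I_m}) : R := \sum_(i in A) i.+1%:R.

(** The map from [(A, x, y)] to [(y |: (A :\ x), y, x)] is an involution that negates [h y - h x].
    So the terms with [F] at the swapped set add up to minus those with [F A], which gives the
    factor 2; it remains to sum [h y - h x] over all pairs for fixed [A]. *)
Lemma swap_identity m (k : nat) (h : 'I_m -> R) (F : {set 'I_m} -> R) :
  \sum_(A : {set 'I_m} | #|A| == k) \sum_(x in A) \sum_(y in ~: A)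
     (h y - h x) * (F (y |: (A :\ x)) - F A)
  = 2 * \sum_(A : {set 'I_m} | #|A| == k)
          (m%:R * \sum_(i in A) h i - k%:R * \sum_i h i) * F A.
Proof.
have anti : \sum_(A : {set 'I_m} | #|A| == k) \sum_(x in A) \sum_(y in ~: A)
     (h y - h x) * F (y |: (A :\ x)) =
   - \sum_(A : {set 'I_m} | #|A| == k) \sum_(x in A) \sum_(y in ~: A)
     (h y - h x) * F A.
  rewrite !pair_big_dep /= -sumrN.
  pose sw (q : {set 'I_m} * 'I_m * 'I_m) := ((q.2 |: (q.1.1 :\ q.1.2), q.2), q.1.2).
  have swK (A : {set 'I_m}) (x y : 'I_m) : x \in A -> y \notin A ->
      x |: ((y |: (A :\ x)) :\ y) = A.
    move=> xA yA; rewrite setU1K ?setD1K // !inE (negPf yA) andbF //.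
  rewrite (reindex_onto sw sw) /=; last first.
    by move=> [[A x] y] /= /andP[/andP[_ xA]]; rewrite inE => yA; rewrite /sw /= swK.
  apply: eq_big => [[[A x] y] | [[A x] y]] /=.
    rewrite !inE !eqxx /=; apply/idP/idP.
      rewrite andbT orbF => /andP[/andP[Ak xy] /eqP[e]].
      have xA : x \in A by rewrite -e !inE eqxx.
      have yA : y \notin A by rewrite -e !inE eqxx /= orbF eq_sym.
      move: Ak; rewrite xA yA cardsU1 !inE (negPf yA) andbF.
      by rewrite (cardsD1 x A) xA !andbT.
    move=> /andP[/andP[Ak xA] yA].
    have xy : x != y by apply: contraNneq yA => <-.
    rewrite /sw /= swK // eqxx (negPf xy) cardsU1 !inE (negPf yA) andbF /= !andbT.
    by move: Ak; rewrite (cardsD1 x A) xA.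
  move=> /andP[/andP[/andP[_ _] _] /eqP[e]]; rewrite e; ring.
under eq_bigr do under eq_bigr do under eq_bigr do rewrite mulrBr.
under eq_bigr do under eq_bigr do rewrite sumrB.
under eq_bigr do rewrite sumrB.
rewrite sumrB anti; set S := \sum_(_ | _) _; set T := \sum_(_ | _) _.
suff -> : S = - T by ring.
rewrite /S /T -sumrN; apply: eq_bigr => A /eqP Ak.
under eq_bigr do rewrite -mulr_suml.
rewrite -mulr_suml -mulNr; congr (_ * _).
under eq_bigr do rewrite sumrB sumr_const.
rewrite sumrB sumr_const Ak.
have e1 : \sum_i h i = \sum_(i in A) h i + \sum_(i in ~: A) h i.
  by rewrite (bigID (mem A)) /=; congr (_ + _); apply: eq_bigl => i; rewrite inE.
have e2 : (m%:R : R) = k%:R + #|~: A|%:R.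
  by rewrite -natrD -Ak cardsC card_ord.
rewrite e1 e2 sumrMnl.
set a := \sum_(_ in A) _; set b := \sum_(_ in ~: A) _; ring.
Qed.

Lemma flip_identity m (k : nat) (G : {set 'I_m} -> 'I_m -> R) :
  \sum_(A : {set 'I_m} | #|A| == k) \sum_(y in ~: A) G (y |: A) y
  = \sum_(A : {set 'I_m} | #|A| == k.+1) \sum_(d in A) G A d.
Proof.
rewrite !pair_big_dep /=.
rewrite [RHS](reindex_onto (fun q : {set 'I_m} * 'I_m => (q.2 |: q.1, q.2))
                   (fun q => (q.1 :\ q.2, q.2))) /=; last first.
  by move=> [A y] /= /andP[_ yA]; rewrite setD1K.
apply: eq_bigl => [[A y]] /=; rewrite !inE eqxx andbT xpair_eqE eqxx andbT cardsU1.
case: (boolP (y \in A)) => yA /=; rewrite ?andbF; last by rewrite setU1K // eqxx andbT.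
by apply/esym/negP => /andP[_ /eqP e]; move: yA; rewrite -e !inE eqxx.
Qed.

(** The image of [lift y] is everything except [y], so the preimage under [lift y] models deleting
    [y] from the ground set and renumbering. *)
Lemma lift_imset_preimset m (y : 'I_m.+1) (A : {set 'I_m.+1}) :
  y \notin A -> lift y @: (lift y @^-1: A) = A.
Proof.
move=> yA; apply/setP=> i; apply/imsetP/idP => [[j]|iA].
  by rewrite inE => jA ->.
case: (unliftP y i) iA => [j -> jA | -> iA]; last by rewrite iA in yA.
by exists j; rewrite ?inE.
Qed.

(** For each of the [m.+1] choices of [y], deletion is a bijection from the [k]-sets avoiding [y] to
    the [k]-sets of the smaller ground set. *)
Lemma delete_identity m (k : nat) (F : {set 'I_m} -> R) :
  \sum_(A : {set 'I_m.+1} | #|A| == k) \sum_(y in ~: A) F (lift y @^-1: A)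
  = m.+1%:R * \sum_(A : {set 'I_m} | #|A| == k) F A.
Proof.
rewrite (exchange_big_dep predT) //=.
rewrite (eq_bigr (fun _ => \sum_(A : {set 'I_m} | #|A| == k) F A)).
  by rewrite sumr_const card_ord mulr_natl.
move=> y _.
rewrite (reindex_onto (fun B : {set 'I_m} => lift y @: B)
                      (fun A => lift y @^-1: A)) /=; last first.
  by move=> A /andP[_]; rewrite inE => yA; rewrite lift_imset_preimset.
have preK (B : {set 'I_m}) : lift y @^-1: (lift y @: B) = B.
  by apply/setP => i; rewrite inE mem_imset //; exact: lift_inj.
apply: eq_big => [B | B _]; last by rewrite preK.
rewrite preK eqxx andbT card_imset ?inE; last exact: lift_inj.
rewrite (_ : y \notin _) ?andbT //.
by apply/imsetP => -[j _] e; move: (neq_lift y j); rewrite -e eqxx.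
Qed.

Lemma ssum_delete m (y : 'I_m.+1) (A : {set 'I_m.+1}) : y \notin A ->
  ssum (lift y @^-1: A) = ssum A - #|[set d in A | y < d]%N|%:R.
Proof.
move=> yA; apply/eqP; rewrite eq_sym subr_eq; apply/eqP.
have key (G : 'I_m.+1 -> R) :
    \sum_(i in A) G i = \sum_(j in lift y @^-1: A) G (lift y j).
  rewrite -[in LHS](lift_imset_preimset yA) big_imset // => i j _ _.
  exact: lift_inj.
rewrite /ssum key -sum1_card natr_sum.
rewrite (eq_bigl (fun d => (d \in A) && (y < d)%N)); last by move=> d; rewrite inE.
rewrite [X in _ + X]big_mkcondr /= key.
rewrite -big_split /=; apply: eq_bigr => i _.
rewrite /= /bump; case: (leqP y i) => iy /=.
  by rewrite add1n ltnS iy -natr1.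
by rewrite add0n ltnNge (ltnW iy) /= addr0.
Qed.

Lemma ssum_setU1 m (y : 'I_m) (A : {set 'I_m}) : y \notin A ->
  ssum (y |: A) = y.+1%:R + ssum A.
Proof. by move=> yA; rewrite /ssum big_setU1. Qed.

Lemma ssum_swap m (A : {set 'I_m}) (x y : 'I_m) : x \in A -> y \notin A ->
  ssum (y |: (A :\ x)) = ssum A + (y.+1%:R - x.+1%:R).
Proof.
move=> xA yA; rewrite ssum_setU1; last by rewrite !inE (negPf yA) andbF.
by rewrite /ssum (big_setD1 x xA) /=; ring.
Qed.

Lemma sum_setC m (A : {set 'I_m}) (G : 'I_m -> R) :
  \sum_(i in ~: A) G i = \sum_i G i - \sum_(i in A) G i.
Proof.
rewrite [\sum_i G i](bigID (mem A)) /= addrC addrK.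
by apply: eq_bigl => i; rewrite inE.
Qed.

Lemma sum_setCU1 m (A : {set 'I_m}) (y : 'I_m) (G : 'I_m -> R) : y \notin A ->
  \sum_(i in ~: (y |: A)) G i = \sum_(i in ~: A) G i - G y.
Proof. by move=> yA; rewrite !sum_setC big_setU1 //=; ring. Qed.

(** Each ordered pair falls under exactly one of [<], [>] and [=]. *)
Lemma sum_ltn_pairs m (A : {set 'I_m}) :
  2 * \sum_(d in A) \sum_(y in A) (y < d)%N%:R = #|A|%:R * (#|A|%:R - 1) :> R.
Proof.
have e : \sum_(d in A) \sum_(y in A) ((y < d)%N%:R + (d < y)%N%:R + (y == d)%:R)
    = \sum_(d in A) \sum_(y in A) 1 :> R.
  apply: eq_bigr => d _; apply: eq_bigr => y _; rewrite -val_eqE /=.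
  by case: ltngtP => _ /=; rewrite ?addr0 ?add0r.
have eqs d : d \in A -> \sum_(y in A) (y == d)%:R = 1 :> R.
  move=> dA; rewrite (bigD1 d) //= eqxx big1 ?addr0 // => i /andP[_ /negPf ->] //.
move: e; under eq_bigr do rewrite !big_split /=.
rewrite !big_split /= (eq_bigr _ eqs) [X in _ + X + _]exchange_big /=.
rewrite !sumr_const; set P := \sum_(_ in _) _ => e.
have {}e : P + P + #|A|%:R = #|A|%:R * #|A|%:R by rewrite e; ring.
by rewrite mulrBr mulr1 -e; ring.
Qed.

(** An element [d], counted from 0, has [d] smaller elements in the ground set; those inside [A] are
    removed by [sum_ltn_pairs]. *)
Lemma sum_ltn_compl m (A : {set 'I_m}) :
  2 * \sum_(y in ~: A) \sum_(d in A) (y < d)%N%:R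
  = 2 * ssum A - #|A|%:R * (#|A|%:R + 1).
Proof.
have tot (d : 'I_m) : \sum_(y : 'I_m) (y < d)%N%:R = d.+1%:R - 1 :> R.
  rewrite -natr1 addrK -natr_sum; congr _%:R.
  transitivity (\sum_(y < m | (y < d)%N) 1)%N.
    by rewrite [RHS]big_mkcond; apply: eq_bigr => y _; case: ltnP.
  by rewrite (big_ord_narrow (ltnW (ltn_ord d))) /= sum1_card card_ord.
rewrite exchange_big /=; under eq_bigr do rewrite sum_setC tot.
rewrite !sumrB mulrBr sum_ltn_pairs sumr_const /ssum; ring.
Qed.

Lemma cardC_natr m (A : {set 'I_m}) : #|~: A|%:R = m%:R - #|A|%:R :> R.
Proof. by apply: (addrI #|A|%:R); rewrite -natrD cardsC card_ord; ring. Qed.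

Lemma sum_sqr_diff m (A : {set 'I_m}) (h : 'I_m -> R) :
  \sum_(x in A) \sum_(y in ~: A) (h y - h x) ^+ 2
  = #|A|%:R * \sum_i h i ^+ 2 + (m%:R - 2 * #|A|%:R) * \sum_(i in A) h i ^+ 2
    - 2 * (\sum_(i in A) h i) * (\sum_i h i) + 2 * (\sum_(i in A) h i) ^+ 2.
Proof.
have e x : \sum_(y in ~: A) (h y - h x) ^+ 2 = \sum_(y in ~: A) h y ^+ 2
    - 2 * (\sum_(y in ~: A) h y) * h x + #|~: A|%:R * h x ^+ 2.
  rewrite -mulrA mulr_suml mulr_sumr -sumrB mulr_natl -sumr_const -big_split /=.
  by apply: eq_bigr => y _; ring.
under eq_bigr do rewrite e.
rewrite big_split sumrB /= sumr_const -!mulr_sumr !sum_setC cardC_natr -mulr_natl; ring.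
Qed.

Lemma sum_succ_ord m : \sum_(i < m) i.+1%:R = m%:R * (m%:R + 1) / 2 :> R.
Proof.
elim: m => [|m IH]; first by rewrite big_ord0; ring.
by rewrite big_ord_recr /= IH -natr1; field.
Qed.

Lemma sum_sqr_succ_ord m :
  \sum_(i < m) i.+1%:R ^+ 2 = m%:R * (m%:R + 1) * (2 * m%:R + 1) / 6 :> R.
Proof.
elim: m => [|m IH]; first by rewrite big_ord0; ring.
by rewrite big_ord_recr /= IH -natr1; field.
Qed.

(* Change of the sum when [y] joins [A] and [z] is then deleted from the ground
   set, which lowers by one the elements above [z]. *)
Definition move_shift m (A : {set 'I_m}) (y z : 'I_m) : R :=
  y.+1%:R - #|[set d in y |: A | z < d]%N|%:R.

Lemma move_shiftE m (A : {set 'I_m}) (y z : 'I_m) : y \notin A ->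
  move_shift A y z = y.+1%:R - (z < y)%N%:R - \sum_(d in A) (z < d)%N%:R.
Proof.
move=> yA; rewrite /move_shift -addrA -opprD; congr (_ - _).
rewrite -sum1_card natr_sum.
rewrite (eq_bigl (fun d => (d \in y |: A) && (z < d)%N)); last by move=> d; rewrite inE.
rewrite big_mkcondr /= (eq_bigr (fun d : 'I_m => (z < d)%N%:R)); last first.
  by move=> d _; case: ltnP.
by rewrite big_setU1.
Qed.

(** Apart from a polynomial in the number [r] of non-elements, the total shift involves [A] only
    through the deviation of [ssum A] from its mean at fixed size, which concentrates. *)
Lemma sum_move_shift m (A : {set 'I_m}) (r : R) : r = m%:R - #|A|%:R ->
  \sum_(y in ~: A) \sum_(z in ~: (y |: A)) move_shift A y z
  = (r - 1) * (r ^+ 2 / 2 - 2 * (ssum A - #|A|%:R * (m%:R + 1) / 2)).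
Proof.
move=> re; have cC : #|~: A|%:R = r by rewrite re cardC_natr.
have e y : y \in ~: A -> \sum_(z in ~: (y |: A)) move_shift A y z =
    (r - 1) * y.+1%:R - \sum_(z in ~: A) (z < y)%N%:R
    - (\sum_(z in ~: A) \sum_(d in A) (z < d)%N%:R) + \sum_(d in A) (y < d)%N%:R.
  rewrite inE => yA; under eq_bigr do rewrite move_shiftE //.
  rewrite sum_setCU1 // !sumrB ltnn sumr_const -[_ *+ #|~: A|]mulr_natl cC mulr0n; ring.
rewrite (eq_bigr _ e) big_split !sumrB /= -mulr_sumr sumr_const -[_ *+ #|~: A|]mulr_natl cC.
have := sum_ltn_pairs (~: A); rewrite cC; set P := \sum_(_ in _) _ => eP.
have := sum_ltn_compl A; set Q := \sum_(_ in _) _ => eQ.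
rewrite sum_setC sum_succ_ord -/(ssum A).
have -> : P = r * (r - 1) / 2 by rewrite -eP; field.
have -> : Q = ssum A - #|A|%:R * (#|A|%:R + 1) / 2 by lra.
by rewrite re; field.
Qed.

(** A given target set arises once for each choice of the element that has joined, [k.+1] ways, and
    of the position of the deleted one, [m.+1] ways. *)
Lemma move_identity m (k : nat) (F : R -> R) :
  \sum_(A : {set 'I_m.+1} | #|A| == k) \sum_(y in ~: A) \sum_(z in ~: (y |: A))
     F (ssum A + move_shift A y z)
  = k.+1%:R * m.+1%:R * \sum_(A : {set 'I_m} | #|A| == k.+1) F (ssum A).
Proof.
pose G (A : {set 'I_m.+1}) := \sum_(z in ~: A) F (ssum (lift z @^-1: A)).
rewrite -mulrA -delete_identity mulr_sumr.
transitivity (\sum_(A : {set 'I_m.+1} | #|A| == k) \sum_(y in ~: A) G (y |: A)).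
  apply: eq_bigr => A _; apply: eq_bigr => y; rewrite inE => yA.
  apply: eq_bigr => z; rewrite inE => zA; congr F.
  by rewrite ssum_delete // ssum_setU1 // /move_shift; ring.
rewrite (flip_identity k (fun A _ => G A)).
by apply: eq_bigr => A /eqP Ak; rewrite sumr_const Ak mulr_natl.
Qed.

End Moves.

(** * Sums over all cores, and the two moves in this setting *)

Section Total.
Local Open Scope ring_scope.
Variables (R : realFieldType) (s : nat).
Implicit Types G H : forall m, {set 'I_m} -> R.

(* The sets in this sum encode the cores: a set [A] of size [k] in ['I_(s - k)]
   stands for the partition with parts [i + 1] for [i] in [A]. *)
Definition tot G : R :=
  \sum_(k < s.+1) \sum_(A : {set 'I_(s - k)} | #|A| == k) G (s - k)%N A.

Lemma tot_ler G H :
  (forall m (A : {set 'I_m}), (#|A| + m = s)%N -> G m A <= H m A) -> tot G <= tot H.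
Proof.
move=> GH; apply: ler_sum => k _; apply: ler_sum => A /eqP Ak.
by apply: GH; rewrite Ak subnKC // -ltnS.
Qed.

Lemma eq_tot G H :
  (forall m (A : {set 'I_m}), (#|A| + m = s)%N -> G m A = H m A) -> tot G = tot H.
Proof.
move=> GH; apply: eq_bigr => k _; apply: eq_bigr => A /eqP Ak.
by apply: GH; rewrite Ak subnKC // -ltnS.
Qed.

Lemma totD G H : tot (fun m A => G m A + H m A) = tot G + tot H.
Proof. by rewrite /tot -big_split; apply: eq_bigr => k _; rewrite -big_split. Qed.

Lemma totZ (c : R) G : tot (fun m A => c * G m A) = c * tot G.
Proof. by rewrite /tot mulr_sumr; apply: eq_bigr => k _; rewrite mulr_sumr. Qed.

Lemma totB G H : tot (fun m A => G m A - H m A) = tot G - tot H.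
Proof. by rewrite /tot -sumrB; apply: eq_bigr => k _; rewrite -sumrB. Qed.

Lemma tot_norm G : `|tot G| <= tot (fun m A => `|G m A|).
Proof.
rewrite /tot; apply: le_trans (ler_norm_sum _ _ _) _.
by apply: ler_sum => k _; exact: ler_norm_sum.
Qed.

Definition weight : R := tot (fun _ _ => 1).

Lemma tot_const (c : R) : tot (fun _ _ => c) = c * weight.
Proof. by rewrite -totZ; apply: eq_tot => m A _; rewrite mulr1. Qed.

Lemma weight_gt0 : 0 < weight.
Proof.
rewrite /weight /tot big_ord_recl /= (bigD1 set0) ?cards0 //=.
rewrite -addrA ltr_pwDl // addr_ge0 //; first exact: sumr_ge0.
by apply: sumr_ge0 => k _; exact: sumr_ge0.
Qed.

Lemma tot_le_const G (c : R) :
  (forall m (A : {set 'I_m}), (#|A| + m = s)%N -> G m A <= c) ->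
  tot G <= c * weight.
Proof. by move=> Gc; rewrite -tot_const; apply: tot_ler. Qed.

(* Since [2 c |G| <= G ^ 2 + c ^ 2]. *)
Lemma tot_norm_le_sqr G (c b : R) : 0 < c ->
  tot (fun m A => G m A ^+ 2) <= b * c ^+ 2 * weight ->
  tot (fun m A => `|G m A|) <= (b + 1) / 2 * c * weight.
Proof.
move=> c0 le.
have : tot (fun m A => 2 * c * `|G m A|) <=
    tot (fun m A => G m A ^+ 2 + c ^+ 2).
  apply: tot_ler => m A _; rewrite -[G m A ^+ 2]real_normK ?num_real //.
  have := sqr_ge0 (`|G m A| - c); nra.
rewrite totZ totD tot_const => h.
rewrite -(ler_pM2l (x := 2 * c)); last by rewrite mulr_gt0.
apply: le_trans h _; lra.
Qed.

Local Notation S := (s%:R : R).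

Lemma tot_move (F : nat -> R -> R) :
  tot (fun m A => #|A|%:R * (S - #|A|%:R + 1) * F #|A| (ssum R A))
  = tot (fun m A => \sum_(y in ~: A) \sum_(z in ~: (y |: A))
           F #|A|.+1 (ssum R A + move_shift R A y z)).
Proof.
pose c k := \sum_(A : {set 'I_(s - k)} | #|A| == k) F k (ssum R A).
transitivity (\sum_(k < s.+1) k%:R * (S - k%:R + 1) * c k).
  apply: eq_bigr => k _; rewrite mulr_sumr; apply: eq_bigr => A /eqP Ak.
  by rewrite Ak.
(* A move leads from [k] to [k + 1] elements and keeps [#|A| + m]. The unmatched terms vanish:
   [k = 0] on the left has the factor 0, and [k = s] on the right has an empty ground set. *)
rewrite big_ord_recl /= !mul0r add0r [RHS]big_ord_recr /= [X in _ = _ + X]big1 ?addr0.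
  apply: eq_bigr => k _.
  transitivity (k.+1%:R * (s - k.+1).+1%:R * c k.+1).
    by rewrite /= /bump /= add1n; congr (_ * _ * _); rewrite -[RHS]natr1 natrB.
  rewrite -(move_identity (s - k.+1) k (F k.+1)) subnSK //.
  by apply: eq_bigr => A /eqP ->.
move=> A _; apply: big1 => y _; case: y => i i0; exfalso.
by rewrite subnn in i0.
Qed.

Definition dev m (h : nat -> R) (A : {set 'I_m}) : R :=
  \sum_(i in A) h i - #|A|%:R * (\sum_(i < m) h i) / m%:R.

Lemma tot_swap (h : nat -> R) (F : forall m, {set 'I_m} -> R) : (0 < s)%N ->
  tot (fun m A => dev h A * F m A)
  = tot (fun m A => (2 * m%:R)^-1 * \sum_(x in A) \sum_(y in ~: A)
           (h y - h x) * (F m (y |: (A :\ x)) - F m A)).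
Proof.
move=> s0; apply: eq_bigr => k _; rewrite -mulr_sumr swap_identity.
(* An empty ground set would have to contain [k = s > 0] elements, so both sums are empty. *)
case: (posnP (s - k)) => [sk | sk].
  rewrite !big_pred0 ?mulr0 // => A; apply/negP => /eqP Ak.
    by have := max_card A; rewrite card_ord; lia.
  by have := max_card A; rewrite card_ord; lia.
have nz : (s - k)%:R != 0 :> R by rewrite pnatr_eq0 -lt0n.
rewrite [in RHS]mulrA mulr_sumr; apply: eq_bigr => A /eqP Ak.
by rewrite /dev Ak; field.
Qed.

End Total.

(** * The truncated linear test function *)

Section Clamp.
Local Open Scope ring_scope.
Variable R : realFieldType.

Lemma norm_mul_le (a b c : R) : `|a| <= c -> `|a * b| <= c * `|b|.
Proof. by move=> ac; rewrite normrM ler_wpM2r. Qed.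

(** The test function for [concentration]: it is bounded, it is monotone, so that every swap
    contributes a nonnegative amount, and it has slope one around [a]. *)
Definition clamp (a b x : R) : R :=
  if x - a <= - b then - b else if b <= x - a then b else x - a.

Lemma clamp_bound (a b x : R) : 0 <= b -> `|clamp a b x| <= b.
Proof.
move=> b0; rewrite /clamp ler_norml.
by case: (leP (x - a) (- b)) => h1; case: (leP b (x - a)) => h2; lra.
Qed.

Lemma clamp_mono (a b x d : R) : 0 <= b ->
  0 <= d * (clamp a b (x + d) - clamp a b x).
Proof.
move=> b0; rewrite /clamp.
case: (leP (x - a) (- b)) => h1; case: (leP b (x - a)) => h2;
case: (leP (x + d - a) (- b)) => h3; case: (leP b (x + d - a)) => h4; nra.
Qed.

Lemma clamp_linear (a b x d : R) : `|x - a| <= b -> `|d| <= b ->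
  clamp a (2 * b) (x + d) - clamp a (2 * b) x = d.
Proof.
rewrite !ler_norml => /andP[? ?] /andP[? ?]; rewrite /clamp.
case: (leP (x - a) (- (2 * b))) => h1; case: (leP (2 * b) (x - a)) => h2;
case: (leP (x + d - a) (- (2 * b))) => h3; case: (leP (2 * b) (x + d - a)) => h4; lra.
Qed.

End Clamp.

(** * Second moments of deviations and the Stein identity for the size *)

Section Moments.
Local Open Scope ring_scope.
Variables (R : realFieldType) (s : nat).
Hypothesis s_gt0 : (0 < s)%N.
Local Notation S := (s%:R : R).
Local Notation tot := (@tot R s).
Local Notation N := (weight R s).
Local Notation ssum := (@ssum R _).

Lemma conf_facts m (A : {set 'I_m}) : (#|A| + m = s)%N ->
  [/\ m%:R = S - #|A|%:R :> R, 0 <= #|A|%:R :> R, 2 * #|A|%:R <= S,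
      1 <= m%:R :> R & 0 <= ssum A <= #|A|%:R * m%:R].
Proof.
move=> e; have Am : (#|A| <= m)%N by have := max_card A; rewrite card_ord.
split.
- by rewrite -e natrD; ring.
- exact: ler0n.
- by rewrite -natrM ler_nat; lia.
- by rewrite ler1n; lia.
apply/andP; split; first by apply: sumr_ge0 => i _; exact: ler0n.
rewrite mulr_natl -sumr_const; apply: ler_sum => i _.
by rewrite ler_nat.
Qed.

Lemma swap_shift_le m (A : {set 'I_m}) (x y : 'I_m) : (#|A| + m = s)%N ->
  `|y.+1%:R - x.+1%:R| <= S.
Proof.
move=> e; have le (i : 'I_m) : i.+1%:R <= S.
  by rewrite ler_nat (leq_trans (ltn_ord i)) // -e leq_addl.
have := le x; have := le y; have := ler0n R x.+1; have := ler0n R y.+1.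
by rewrite ler_norml; lra.
Qed.

Lemma sum_pairs_const m (A : {set 'I_m}) (c : R) :
  \sum_(x in A) \sum_(y in ~: A) c = #|A|%:R * (m%:R - #|A|%:R) * c.
Proof. by rewrite !sumr_const -cardC_natr; ring. Qed.

Lemma sum_moves_const m (A : {set 'I_m}) (c : R) :
  \sum_(y in ~: A) \sum_(z in ~: (y |: A)) c
  = (m%:R - #|A|%:R) * (m%:R - #|A|%:R - 1) * c.
Proof.
rewrite (eq_bigr (fun _ => (m%:R - #|A|%:R - 1) * c)); last first.
  move=> y; rewrite inE => yA; rewrite sumr_const -[_ *+ #|~: _|]mulr_natl cardC_natr cardsU1 yA add1n -natr1.
  by ring.
by rewrite sumr_const -[_ *+ #|~: _|]mulr_natl cardC_natr; ring.
Qed.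

Lemma dev_swap m (h : nat -> R) (A : {set 'I_m}) (x y : 'I_m) :
  x \in A -> y \notin A -> dev h (y |: (A :\ x)) - dev h A = h y - h x.
Proof.
move=> xA yA; have yAx : y \notin A :\ x by rewrite !inE (negPf yA) andbF.
rewrite /dev cardsU1 yAx add1n big_setU1 //= (big_setD1 x xA) /= (cardsD1 x A) xA add1n.
by ring.
Qed.

(** The swap identity with [dev h] itself as test function: a swap changes it by exactly
    [h y - h x], so each term is a square of size at most [c ^ 2], and the total weight
    [k (m - k) / (2 m)] of the swaps is at most [S]. *)
Lemma tot_dev_sqr_le (h : nat -> R) (c : R) :
  (forall i j, (i < s)%N -> (j < s)%N -> `|h i - h j| <= c) ->
  tot (fun m A => dev h A ^+ 2) <= S * c ^+ 2 * N.
Proof.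
move=> hc; rewrite (eq_tot (H := fun m A => dev h A * dev h A)) //.
rewrite tot_swap //; apply: tot_le_const => m A e.
have [mE k0 kS m1 _] := conf_facts e.
apply: (@le_trans _ _ ((2 * m%:R)^-1 * (#|A|%:R * (m%:R - #|A|%:R) * c ^+ 2))).
  rewrite ler_wpM2l ?invr_ge0 ?mulr_ge0 // -sum_pairs_const.
  apply: ler_sum => x xA; apply: ler_sum => y; rewrite inE => yA.
  rewrite dev_swap // -expr2 -real_normK ?num_real // ler_pXn2r ?nnegrE //.
    by apply: hc; have := ltn_ord x; have := ltn_ord y; lia.
  by apply: le_trans (hc 0 0 s_gt0 s_gt0).
rewrite ler_pdivrMl; last lra.
have c2 : 0 <= c ^+ 2 by exact: sqr_ge0.
rewrite [leRHS]mulrCA [leRHS]mulrC -mulrA [leRHS]mulrAC mulrA ler_wpM2r //; nra.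
Qed.

Definition centre m (A : {set 'I_m}) : R := ssum A - #|A|%:R * (m%:R + 1) / 2.

Lemma centre_dev m (A : {set 'I_m}) : (0 < m)%N ->
  centre A = dev (fun i => i.+1%:R) A.
Proof.
move=> m0; rewrite /centre /dev sum_succ_ord /ssum.
have nz : m%:R != 0 :> R by rewrite pnatr_eq0 -lt0n.
by field.
Qed.

(** The value of [swap_diff] at a linear function of slope one, hence the coefficient of the
    derivative when a test function is expanded to first order. *)
Definition swap_var m (A : {set 'I_m}) : R :=
  (2 * m%:R)^-1 * \sum_(x in A) \sum_(y in ~: A) (y.+1%:R - x.+1%:R) ^+ 2.

Definition swap_diff m (F : R -> R) (A : {set 'I_m}) : R :=
  (2 * m%:R)^-1 * \sum_(x in A) \sum_(y in ~: A)
     (y.+1%:R - x.+1%:R) * (F (ssum A + (y.+1%:R - x.+1%:R)) - F (ssum A)).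

Lemma conf_m_gt0 m (A : {set 'I_m}) : (#|A| + m = s)%N -> (0 < m)%N.
Proof. by move=> e; have := max_card A; rewrite card_ord; lia. Qed.

Lemma tot_centre (F : R -> R) :
  tot (fun m A => centre A * F (ssum A)) = tot (fun m A => swap_diff F A).
Proof.
rewrite (eq_tot (H := fun m A => dev (fun i => i.+1%:R) A * F (ssum A))); last first.
  by move=> m A e; rewrite centre_dev // (conf_m_gt0 e).
rewrite tot_swap //; apply: eq_tot => m A _; congr (_ * _).
apply: eq_bigr => x xA; apply: eq_bigr => y; rewrite inE => yA.
by rewrite ssum_swap.
Qed.

Definition move_diff m (F : R -> R) (A : {set 'I_m}) : R :=
  \sum_(y in ~: A) \sum_(z in ~: (y |: A)) (F (ssum A + move_shift R A y z) - F (ssum A)).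

(** With [k = #|A|], the factor is the number [k (s - k + 1)] of moves that arrive at a set minus
    the number [(s - 2 k) (s - 2 k - 1)] of moves that leave it. *)
Lemma tot_move_diff (F : R -> R) :
  tot (fun m A => (10 * (#|A|%:R * (m%:R + 1) / 2) - 6 * #|A|%:R - S ^+ 2 + S)
                  * F (ssum A)) = tot (fun m A => move_diff F A).
Proof.
rewrite (eq_tot (H := fun m A => #|A|%:R * (S - #|A|%:R + 1) * F (ssum A) -
   (m%:R - #|A|%:R) * (m%:R - #|A|%:R - 1) * F (ssum A))); last first.
  by move=> m A /conf_facts[-> _ _ _ _]; field.
rewrite totB (tot_move s (fun _ => F)) -totB; apply: eq_tot => m A _.
rewrite /move_diff -sum_moves_const -sumrB; apply: eq_bigr => y _.
by rewrite sumrB.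
Qed.

Definition mean : R := tot (fun m A => ssum A) / N.
Definition mean_card : R := tot (fun m A => #|A|%:R) / N.

Definition stein_op m (F : R -> R) (A : {set 'I_m}) : R :=
  swap_diff F A + move_diff F A / 10.

Lemma N_neq0 : N != 0.
Proof. by rewrite gt_eqF // weight_gt0. Qed.

(** For a constant test function all increments vanish, so the left-hand factors of both identities
    have mean zero. *)
Lemma mean_eq : 10 * mean = 6 * mean_card + S ^+ 2 - S.
Proof.
have e1 := tot_centre (fun _ => 1); have e2 := tot_move_diff (fun _ => 1).
have z1 : tot (fun m A => swap_diff (fun _ => 1) A) = 0.
  rewrite -(mul0r N); rewrite -tot_const; apply: eq_tot => m A _.
  by rewrite /swap_diff big1 ?mulr0 // => x _; apply: big1 => y _; rewrite subrr mulr0.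
have z2 : tot (fun m A => move_diff (fun _ => 1) A) = 0.
  rewrite -(mul0r N); rewrite -tot_const; apply: eq_tot => m A _.
  by rewrite /move_diff big1 // => x _; apply: big1 => y _; rewrite subrr.
rewrite z1 in e1; rewrite z2 in e2.
have : tot (fun m A => 10 * ssum A - (6 * #|A|%:R + (S ^+ 2 - S))) = 0.
  rewrite (eq_tot (H := fun m A => 10 * (centre A * 1) +
    (10 * (#|A|%:R * (m%:R + 1) / 2) - 6 * #|A|%:R - S ^+ 2 + S) * 1)).
    by rewrite totD totZ e1 e2 mulr0 addr0.
  by move=> m A _; rewrite /centre; ring.
rewrite totB totD !totZ tot_const => e; rewrite /mean /mean_card.
have -> : tot (fun m A => ssum A) =
  (6 * tot (fun m A => #|A|%:R) + (S ^+ 2 - S) * N) / 10 by lra.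
by field; rewrite N_neq0.
Qed.

(** A tenth of [tot_move_diff] supplies [mu_k], which completes [centre] to [ssum A]. By [mean_eq]
    the constants cancel, and [6 / 10] of the fluctuation of the number of parts is left over. *)
Lemma tot_stein (F : R -> R) :
  tot (fun m A => (ssum A - mean) * F (ssum A))
  = tot (fun m A => stein_op F A) +
    3 / 5 * tot (fun m A => (#|A|%:R - mean_card) * F (ssum A)).
Proof.
have e := mean_eq.
rewrite /stein_op totD -tot_centre.
rewrite (eq_tot (G := fun m A => move_diff F A / 10)
  (H := fun m A => 10^-1 * move_diff F A)); last by move=> *; rewrite mulrC.
rewrite totZ -tot_move_diff -!totZ -!totD; apply: eq_tot => m A _.
rewrite /centre; have -> : mean = (6 * mean_card + S ^+ 2 - S) / 10 by lra.
by field.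
Qed.

End Moments.

(** * Concentration of the number of parts, of the conditional variance and of the size *)

Section Estimates.
Local Open Scope ring_scope.
Variables (R : realFieldType) (s : nat) (t kap : R).
Hypothesis s_gt0 : (0 < s)%N.
Local Notation S := (s%:R : R).
Hypothesis t_gt0 : 0 < t.
Hypothesis t_sqr : t ^+ 2 = S.
(* Critical density of parts: the drift [5 k (s - k) - s ^ 2] of the number [k]
   of parts under the moves vanishes at [k = kap * s]. *)
Hypothesis kap_root : 5 * kap * (1 - kap) = 1.
Hypothesis kap_bounds : 1 / 4 <= kap <= 3 / 10.
Local Notation tot := (@tot R s).
Local Notation N := (weight R s).
Local Notation ssum := (@ssum R _).
Local Notation K A := (#|A|%:R : R).

Lemma S_ge1 : 1 <= S. Proof. by rewrite ler1n. Qed.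

Lemma t_ge1 : 1 <= t.
Proof.
rewrite leNgt; apply/negP => t1; have := S_ge1; rewrite -t_sqr.
by have := t_gt0; nra.
Qed.

(** The move identity with test function [k - kap * S]. The drift is a quadratic in [k] whose other
    root [(1 - kap) * S] lies at least [S / 5] above every admissible [k], since [k <= S / 2]; so
    the main term dominates [S * (k - kap * S) ^+ 2], and the two remaining terms cost at most
    [S ^+ 2] each. *)
Lemma tot_card_sqr : tot (fun m A => (K A - kap * S) ^+ 2) <= 2 * t ^+ 2 * N.
Proof.
have S1 := S_ge1; have /andP[kap1 kap2] := kap_bounds.
have := tot_move s (fun k (_ : R) => k%:R - kap * S).
rewrite [RHS](eq_tot (H := fun m A =>
    (S - 2 * K A) * (S - 2 * K A - 1) * (K A + 1 - kap * S))); last first.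
  move=> m A /conf_facts-/(_ R s_gt0)[mE _ _ _ _].
  by rewrite sum_moves_const mE -natr1; ring.
move=> e; rewrite t_sqr -(ler_pM2l (x := S)); last lra.
rewrite -totZ; have -> : S * (2 * S * N) = 2 * S ^+ 2 * N by ring.
have e2 : tot (fun m A => 5 * (K A - kap * S) ^+ 2 * (S - K A - kap * S)
     + (S - K A) * (K A - kap * S) - (S - 2 * K A) * (S - 2 * K A - 1)) = 0.
  rewrite -[RHS](subrr (tot (fun m A =>
    (S - 2 * K A) * (S - 2 * K A - 1) * (K A + 1 - kap * S)))) -{1}e -totB.
  apply: eq_tot => m A _.
  have q : 5 * (K A - kap * S) * (S - K A - kap * S)
      = 5 * K A * S - 5 * K A ^+ 2 - S ^+ 2.
    transitivity (5 * K A * S - 5 * K A ^+ 2 - 5 * kap * (1 - kap) * S ^+ 2).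
      by ring.
    by rewrite kap_root mul1r.
  have -> : 5 * (K A - kap * S) ^+ 2 * (S - K A - kap * S) =
    5 * (K A - kap * S) * (S - K A - kap * S) * (K A - kap * S) by ring.
  by rewrite q; ring.
rewrite -tot_const -[leRHS]addr0 -e2 -totD; apply: tot_ler => m A.
move=> /conf_facts-/(_ R s_gt0)[mE k0 kS m1 _].
set k := K A in mE k0 kS *; set d := k - kap * S.
have h1 : S / 5 <= S - k - kap * S by nra.
have h2 : S * d ^+ 2 <= 5 * d ^+ 2 * (S - k - kap * S).
  have := sqr_ge0 d; nra.
have h3 : - S ^+ 2 <= (S - k) * d by rewrite /d; nra.
have h4 : (S - 2 * k) * (S - 2 * k - 1) <= S ^+ 2 by nra.
lra.
Qed.

Lemma tot_card_norm : tot (fun m A => `|K A - kap * S|) <= 3 / 2 * t * N.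
Proof.
have := tot_norm_le_sqr t_gt0 tot_card_sqr; have -> // : (2 + 1) / 2 = 3 / 2 :> R.
by ring.
Qed.

Lemma tot_dev_norm (h : nat -> R) (c b : R) : 0 < c -> S * b ^+ 2 = c ^+ 2 ->
  (forall i j, (i < s)%N -> (j < s)%N -> `|h i - h j| <= b) ->
  tot (fun m A => `|dev h A|) <= c * N.
Proof.
move=> c0 bc hb; have := tot_dev_sqr_le s_gt0 hb; rewrite bc -[c ^+ 2]mul1r.
by move=> /(tot_norm_le_sqr c0); have -> : (1 + 1) / 2 * c = c by field.
Qed.

Lemma tot_centre_norm : tot (fun m A => `|centre R A|) <= t ^+ 3 * N.
Proof.
rewrite (eq_tot (H := fun m A => `|dev (fun i => i.+1%:R) A|)); last first.
  by move=> m A e; rewrite centre_dev // (conf_m_gt0 s_gt0 e).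
apply: (@tot_dev_norm _ _ S); first by rewrite exprn_gt0.
  by rewrite -t_sqr; ring.
move=> i j iS jS; rewrite ler_norml.
have [i1 j1] : i.+1%:R <= S /\ j.+1%:R <= S by rewrite !ler_nat.
by have := ler0n R i.+1; have := ler0n R j.+1; lra.
Qed.

Definition sqdev m (A : {set 'I_m}) : R := dev (fun i => i.+1%:R ^+ 2) A.

Lemma tot_sqdev_norm : tot (fun m A => `|sqdev A|) <= t ^+ 5 * N.
Proof.
apply: (@tot_dev_norm _ _ (S ^+ 2)); first by rewrite exprn_gt0.
  by rewrite -t_sqr; ring.
move=> i j iS jS; rewrite ler_norml.
have [i1 j1] : i.+1%:R <= S /\ j.+1%:R <= S by rewrite !ler_nat.
by have := ler0n R i.+1; have := ler0n R j.+1; nra.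
Qed.

(** The leading term of [swap_var] at the critical number [kap * S] of parts; [move_lim] is the same
    for [move_var]. *)
Definition swap_lim : R := (kap * S) * (S - 2 * (kap * S)) * (S - kap * S) / 12.
Definition move_lim : R := (S - 2 * (kap * S)) ^+ 3 / 20.

(** The first term is the value reached when the sums of the elements and of their squares both
    equal their means for the given [#|A|]. *)
Lemma swap_varE m (A : {set 'I_m}) : (#|A| + m = s)%N ->
  swap_var R A = K A * (m%:R - K A) * (m%:R ^+ 2 - 1) / (12 * m%:R)
    + ((m%:R - 2 * K A) / (2 * m%:R) * sqdev A
      + (ssum A / m%:R + K A * (m%:R + 1) / (2 * m%:R) - (m%:R + 1) / 2) * centre R A).
Proof.
move=> e; have nz : m%:R != 0 :> R by rewrite pnatr_eq0 -lt0n (conf_m_gt0 s_gt0 e).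
rewrite /swap_var (sum_sqr_diff A (fun i => i.+1%:R)) /sqdev /dev.
rewrite sum_succ_ord sum_sqr_succ_ord /centre -/ssum.
set q := \sum_(i in A) _; have -> : \sum_(i in A) i.+1%:R = ssum A by [].
by field.
Qed.

Lemma swap_var_near m (A : {set 'I_m}) : (#|A| + m = s)%N ->
  `|swap_var R A - swap_lim| <=
  `|sqdev A| + 4 * S * `|centre R A| + S ^+ 2 * `|K A - kap * S| + S.
Proof.
move=> e; rewrite swap_varE //.
have [mE k0 kS m1 /andP[x0 x1]] := conf_facts R s_gt0 e.
have /andP[kap1 kap2] := kap_bounds; have S1 := S_ge1.
set k := K A in mE k0 kS x1 *; set M := m%:R in mE m1 x1 *.
set x := ssum A in x0 x1 *; set k' := kap * S.
have k'0 : 0 <= k' by rewrite /k'; nra.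
have k'S : k' <= S by rewrite /k'; nra.
have M0 : 0 < M by lra.
set q := sqdev A; set cc := centre R A.
(* The term with [k - k'] comes from the divided difference of the cubic [k (S - 2 k) (S - k)], and
   the last one from the [- 1] in [M ^+ 2 - 1]. *)
have -> : k * (M - k) * (M ^+ 2 - 1) / (12 * M) +
   ((M - 2 * k) / (2 * M) * q + (x / M + k * (M + 1) / (2 * M) - (M + 1) / 2) * cc)
   - swap_lim =
   (M - 2 * k) / (2 * M) * q + (x / M + k * (M + 1) / (2 * M) - (M + 1) / 2) * cc
   + (S ^+ 2 - 3 * S * (k + k') + 2 * (k ^+ 2 + k * k' + k' ^+ 2)) / 12 * (k - k')
   - k * (M - k) / (12 * M).
  by rewrite /swap_lim -/k' mE; field; rewrite -mE gt_eqF.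
have b1 : `|(M - 2 * k) / (2 * M) * q| <= `|q|.
  rewrite -[leRHS]mul1r; apply: norm_mul_le; rewrite ler_norml.
  by rewrite ler_pdivlMr ?ler_pdivrMr; lra.
have b2 : `|(x / M + k * (M + 1) / (2 * M) - (M + 1) / 2) * cc| <= 4 * S * `|cc|.
  apply: norm_mul_le; rewrite ler_norml.
  have y0 : 0 <= x / M by rewrite divr_ge0 // ltW.
  have y1 : x / M <= k by rewrite ler_pdivrMr.
  have z0 : 0 <= k * (M + 1) / (2 * M) by rewrite divr_ge0 ?mulr_ge0 //; lra.
  have z1 : k * (M + 1) / (2 * M) <= k by rewrite ler_pdivrMr; nra.
  lra.
have b3 : `|(S ^+ 2 - 3 * S * (k + k') + 2 * (k ^+ 2 + k * k' + k' ^+ 2)) / 12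
    * (k - k')| <= S ^+ 2 * `|k - k'|.
  by apply: norm_mul_le; rewrite ler_norml; apply/andP; split; nra.
have b4 : `|k * (M - k) / (12 * M)| <= S.
  rewrite ger0_norm; last by rewrite divr_ge0 ?mulr_ge0 //; lra.
  by rewrite ler_pdivrMr; [nra | lra].
apply: le_trans (ler_normB _ _) _; apply: lerD => //.
apply: le_trans (ler_normD _ _) _; apply: lerD => //.
by apply: le_trans (ler_normD _ _) _; apply: lerD.
Qed.

Definition move_var m (A : {set 'I_m}) : R :=
  (\sum_(y in ~: A) \sum_(z in ~: (y |: A)) move_shift R A y z) / 10.

Lemma move_var_near m (A : {set 'I_m}) : (#|A| + m = s)%N ->
  `|move_var A - move_lim| <=
  S * `|centre R A| + S ^+ 2 * `|K A - kap * S| + S ^+ 2.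
Proof.
move=> e; have [mE k0 kS m1 _] := conf_facts R s_gt0 e.
have /andP[kap1 kap2] := kap_bounds; have S1 := S_ge1.
rewrite /move_var (@sum_move_shift _ _ _ (S - 2 * K A)); last by rewrite mE; ring.
rewrite -/(centre R A).
set k := K A in mE k0 kS *; set k' := kap * S; set cc := centre R A.
have k'0 : 0 <= k' by rewrite /k'; nra.
have k'S : 2 * k' <= S by rewrite /k'; nra.
set r := S - 2 * k; set r' := S - 2 * k'.
have [r0 rS] : 0 <= r /\ r <= S by rewrite /r; lra.
have [r'0 r'S] : 0 <= r' /\ r' <= S by rewrite /r'; lra.
have -> : (r - 1) * (r ^+ 2 / 2 - 2 * cc) / 10 - move_lim =
  (1 - r) / 5 * cc + - (r ^+ 2 + r * r' + r' ^+ 2) / 10 * (k - k') - r ^+ 2 / 20.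
  rewrite /move_lim -/k' -/r'; have -> : k - k' = (r' - r) / 2 by rewrite /r /r'; field.
  by field.
have b1 : `|(1 - r) / 5 * cc| <= S * `|cc|.
  by apply: norm_mul_le; rewrite ler_norml; lra.
have b2 : `|- (r ^+ 2 + r * r' + r' ^+ 2) / 10 * (k - k')| <= S ^+ 2 * `|k - k'|.
  by apply: norm_mul_le; rewrite ler_norml; apply/andP; split; nra.
have b3 : `|r ^+ 2 / 20| <= S ^+ 2.
  by rewrite ger0_norm; nra.
apply: le_trans (ler_normB _ _) _; apply: lerD => //.
by apply: le_trans (ler_normD _ _) _; apply: lerD.
Qed.

(** Each error term has mean of order at most [t ^+ 5], one factor [t] below the order of
    [swap_lim]. *)
Lemma tot_swap_var_near :
  tot (fun m A => `|swap_var R A - swap_lim|) <= 8 * t ^+ 5 * N.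
Proof.
have N0 := weight_gt0 R s; have t1 := t_ge1.
apply: (@le_trans _ _ (tot (fun m A => `|sqdev A| + 4 * S * `|centre R A| +
    S ^+ 2 * `|K A - kap * S| + S))); first exact: tot_ler swap_var_near.
rewrite !totD !totZ tot_const.
have b1 := tot_sqdev_norm.
have b2 : 4 * S * tot (fun m A => `|centre R A|) <= 4 * S * (t ^+ 3 * N).
  by rewrite ler_wpM2l ?tot_centre_norm // mulr_ge0.
have b3 : S ^+ 2 * tot (fun m A => `|K A - kap * S|) <= S ^+ 2 * (3 / 2 * t * N).
  by rewrite ler_wpM2l ?tot_card_norm // exprn_ge0.
have b4 : S * N <= t ^+ 5 * N.
  by rewrite ler_wpM2r ?(ltW N0) // -t_sqr ler_weXn2l.
have -> : 8 * t ^+ 5 * N = t ^+ 5 * N + 4 * S * (t ^+ 3 * N) + S ^+ 2 * (2 * t * N) + t ^+ 5 * N.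
  by rewrite -t_sqr; ring.
apply: lerD b4; apply: lerD; first exact: lerD.
apply: le_trans b3 _; rewrite ler_wpM2l ?exprn_ge0 // ler_wpM2r ?(ltW N0) //; lra.
Qed.

Lemma tot_move_var_near :
  tot (fun m A => `|move_var A - move_lim|) <= 4 * t ^+ 5 * N.
Proof.
have N0 := weight_gt0 R s; have t1 := t_ge1.
apply: (@le_trans _ _ (tot (fun m A => S * `|centre R A| +
    S ^+ 2 * `|K A - kap * S| + S ^+ 2))); first exact: tot_ler move_var_near.
rewrite !totD tot_const !totZ.
have b2 : S * tot (fun m A => `|centre R A|) <= S * (t ^+ 3 * N).
  by rewrite ler_wpM2l ?tot_centre_norm.
have b3 : S ^+ 2 * tot (fun m A => `|K A - kap * S|) <= S ^+ 2 * (3 / 2 * t * N).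
  by rewrite ler_wpM2l ?tot_card_norm // exprn_ge0.
have b4 : S ^+ 2 * N <= t ^+ 5 * N.
  by rewrite ler_wpM2r ?(ltW N0) // -t_sqr -exprM ler_weXn2l.
have -> : 4 * t ^+ 5 * N = S * (t ^+ 3 * N) + S ^+ 2 * (2 * t * N) + t ^+ 5 * N.
  by rewrite -t_sqr; ring.
apply: lerD b4; apply: lerD => //.
apply: le_trans b3 _; rewrite ler_wpM2l ?exprn_ge0 // ler_wpM2r ?(ltW N0) //; lra.
Qed.

(** The constant is [1 / 12] times [kap * (1 - kap) = 1 / 5] times the lower bound [2 / 5] for
    [1 - 2 * kap]. *)
Lemma swap_lim_ge : t ^+ 6 / 150 <= swap_lim.
Proof.
have /andP[kap1 kap2] := kap_bounds.
have -> : swap_lim = t ^+ 6 / 12 * (kap * (1 - kap)) * (1 - 2 * kap).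
  by rewrite /swap_lim -t_sqr; field.
have -> : kap * (1 - kap) = 1 / 5 by have := kap_root; rewrite -mulrA => h; lra.
have : 0 <= t ^+ 6 by rewrite exprn_ge0 // ltW.
nra.
Qed.

(** In the swap identity for [clamp a (2 * S)], sets with [ssum A] within [S] of [a] contribute all
    of [swap_var], of order [t ^+ 6], and the others a nonnegative amount, while the left side is at
    most [2 * S] times the mean of [|centre|], of order [t ^+ 5]. The constant is
    [150 * (2 + 8)]. *)
Lemma concentration (a : R) :
  tot (fun m A => (`|ssum A - a| <= S)%R%:R) <= 1500 / t * N.
Proof.
have N0 := weight_gt0 R s; have S1 := S_ge1.
have main : tot (fun m A => (`|ssum A - a| <= S)%R%:R * swap_var R A) <= 2 * t ^+ 5 * N.
  apply: (@le_trans _ _ (tot (fun m A => swap_diff (clamp a (2 * S)) A))).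
    apply: tot_ler => m A e.
    have [mE k0 kS m1 _] := conf_facts R s_gt0 e.
    rewrite /swap_var /swap_diff mulrCA ler_wpM2l //.
      by rewrite invr_ge0; lra.
    rewrite mulr_sumr; apply: ler_sum => x _; rewrite mulr_sumr; apply: ler_sum => y _.
    case: (boolP (`|_| <= _)) => h /=; rewrite ?mul1r ?mul0r; last first.
      by apply: clamp_mono; lra.
    by rewrite clamp_linear // ?expr2 // (swap_shift_le _ _ _ e).
  rewrite -(tot_centre s_gt0).
  apply: (@le_trans _ _ (tot (fun m A => 2 * S * `|centre R A|))).
    apply: tot_ler => m A _; apply: le_trans (ler_norm _) _; rewrite mulrC.
    by apply: norm_mul_le; apply: clamp_bound; lra.
  rewrite totZ; apply: le_trans (ler_wpM2l _ tot_centre_norm) _; first lra.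
  by rewrite -t_sqr le_eqVlt; apply/orP; left; apply/eqP; ring.
have near := tot_swap_var_near.
have : swap_lim * tot (fun m A => (`|ssum A - a| <= S)%R%:R) <= 10 * t ^+ 5 * N.
  rewrite -totZ; apply: (@le_trans _ _ (tot (fun m A =>
    (`|ssum A - a| <= S)%R%:R * swap_var R A + `|swap_var R A - swap_lim|))).
    apply: tot_ler => m A _; case: (_ <= S) => /=; last by rewrite mulr0 mul0r add0r.
    by rewrite mulr1 mul1r distrC -lerBlDl ler_norm.
  by rewrite totD; lra.
have lim := swap_lim_ge; set P := tot _ => le.
have P0 : 0 <= P by rewrite -(mul0r N) -tot_const; apply: tot_ler => m A _.
have le2 : t ^+ 6 / 150 * P <= 10 * t ^+ 5 * N.
  by apply: le_trans le; rewrite ler_wpM2r.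
have t5 : 0 < t ^+ 5 by rewrite exprn_gt0.
rewrite -(ler_pM2l (x := t ^+ 6 / 150)); last by rewrite divr_gt0 // exprn_gt0.
apply: le_trans le2 _; rewrite le_eqVlt; apply/orP; left; apply/eqP.
by field; rewrite gt_eqF.
Qed.


Lemma tot_mean_card_norm : tot (fun m A => `|K A - mean_card R s|) <= 3 * t * N.
Proof.
have N0 := weight_gt0 R s.
have le : `|kap * S - mean_card R s| * N <= 3 / 2 * t * N.
  rewrite -[N in X in X <= _](ger0_norm (ltW N0)) -normrM mulrBl /mean_card.
  rewrite divfK ?N_neq0 // -tot_const -totB.
  apply: le_trans (tot_norm _ _) _; apply: le_trans tot_card_norm.
  by apply: tot_ler => m A _; rewrite distrC.
apply: (@le_trans _ _ (tot (fun m A => `|K A - kap * S| + `|kap * S - mean_card R s|))).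
  apply: tot_ler => m A _; apply: le_trans (ler_normD _ _).
  by rewrite subrKA.
by rewrite totD tot_const; have := tot_card_norm; lra.
Qed.

Definition total_var m (A : {set 'I_m}) : R := swap_var R A + move_var A.
Definition total_lim : R := swap_lim + move_lim.
Definition variance : R := tot (fun m A => (ssum A - mean R s) ^+ 2) / N.

Lemma tot_total_var_near :
  tot (fun m A => `|total_var A - total_lim|) <= 12 * t ^+ 5 * N.
Proof.
apply: (@le_trans _ _ (tot (fun m A => `|swap_var R A - swap_lim| + `|move_var A - move_lim|))).
  apply: tot_ler => m A _; apply: le_trans (ler_normD _ _).
  by rewrite /total_var /total_lim opprD addrACA.
by rewrite totD; have := tot_swap_var_near; have := tot_move_var_near; lra.
Qed.

Lemma ssum_mean_le m (A : {set 'I_m}) : (#|A| + m = s)%N -> `|ssum A - mean R s| <= S ^+ 2.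
Proof.
have bd m' (A' : {set 'I_m'}) : (#|A'| + m' = s)%N -> 0 <= ssum A' <= S ^+ 2.
  move=> e; have [mE k0 kS m1 /andP[-> x1]] := conf_facts R s_gt0 e.
  by apply: le_trans x1 _; rewrite mE; nra.
have N0 := weight_gt0 R s.
have [m0 m1] : 0 <= mean R s /\ mean R s <= S ^+ 2.
  rewrite /mean; split.
    rewrite divr_ge0 ?(ltW N0) // -(mul0r N) -tot_const.
    by apply: tot_ler => m' A' /bd /andP[].
  by rewrite ler_pdivrMr //; apply: tot_le_const => m' A' /bd /andP[].
by move=> /bd /andP[x0 x1]; rewrite ler_norml; lra.
Qed.

Lemma stein_op_linear m (A : {set 'I_m}) : stein_op (fun x => x - mean R s) A = total_var A.
Proof.
rewrite /stein_op /total_var /swap_diff /swap_var /move_diff /move_var.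
congr (_ * _ + _ / _).
  by apply: eq_bigr => x _; apply: eq_bigr => y _; ring.
by apply: eq_bigr => x _; apply: eq_bigr => y _; ring.
Qed.

(** The Stein identity for [F x = x - mean], where [stein_op] becomes [total_var]. In the term with
    the number of parts the crude bound [S ^+ 2] on the deviation of [ssum A] is enough, since that
    number fluctuates only by order [t]. *)
Lemma variance_near : `|variance - total_lim| <= 14 * t ^+ 5.
Proof.
have N0 := weight_gt0 R s.
rewrite -(ler_pM2r N0) -{1}(ger0_norm (ltW N0)) -normrM mulrBl /variance divfK ?N_neq0 //.
have := tot_stein s_gt0 (fun x => x - mean R s).
rewrite (eq_tot (G := fun m A => stein_op _ A) (fun m A _ => stein_op_linear A)).
rewrite -(eq_tot (G := fun m A => (ssum A - mean R s) ^+ 2)); last by move=> *; rewrite expr2.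
move=> ->; rewrite addrAC -tot_const -totB.
apply: le_trans (ler_normD _ _) _.
have -> : 14 * t ^+ 5 * N = 12 * t ^+ 5 * N + 2 * t ^+ 5 * N by ring.
apply: lerD; first exact: le_trans (tot_norm _ _) tot_total_var_near.
rewrite normrM ger0_norm; last by lra.
have h : `|tot (fun m A => (K A - mean_card R s) * (ssum A - mean R s))| <= S ^+ 2 * (3 * t * N).
  apply: le_trans (tot_norm _ _) _.
  apply: le_trans (ler_wpM2l _ tot_mean_card_norm); last by rewrite exprn_ge0.
  rewrite -totZ; apply: tot_ler => m A e; rewrite mulrC.
  exact: norm_mul_le (ssum_mean_le e).
have t5 : 0 <= t ^+ 5 * N by rewrite mulr_ge0 ?exprn_ge0 // ltW.
have e : S ^+ 2 * (3 * t * N) = 3 * (t ^+ 5 * N) by rewrite -t_sqr; ring.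
by rewrite e in h; rewrite -[2 * _ * _]mulrA; lra.
Qed.

Lemma tot_total_var_variance :
  tot (fun m A => `|total_var A - variance|) <= 26 * t ^+ 5 * N.
Proof.
have N0 := weight_gt0 R s.
apply: (@le_trans _ _ (tot (fun m A => `|total_var A - total_lim| + 14 * t ^+ 5))).
  apply: tot_ler => m A _; apply: (@le_trans _ _ (`|total_var A - total_lim| + `|total_lim - variance|)).
    by apply: le_trans (ler_normD _ _); rewrite subrKA.
  by rewrite lerD2l distrC variance_near.
by rewrite totD tot_const; have := tot_total_var_near; lra.
Qed.

(** From [t = 4200] on, the error [14 * t ^+ 5] is at most [t ^+ 6 / 300], half of the lower bound
    for [swap_lim]. *)
Lemma variance_ge : 4200 <= t -> t ^+ 6 / 400 <= variance.
Proof.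
move=> t1; have := variance_near; rewrite ler_norml => /andP[h _].
have /andP[kap1 kap2] := kap_bounds; have l1 := swap_lim_ge.
have l2 : 0 <= move_lim.
  rewrite /move_lim divr_ge0 // exprn_ge0 //; have := S_ge1; nra.
have t5 : 0 < t ^+ 5 by rewrite exprn_gt0.
have t6 : 4200 * t ^+ 5 <= t ^+ 6 by rewrite [t ^+ 6]exprS ler_wpM2r // ltW.
by rewrite /total_lim in h; lra.
Qed.

End Estimates.

(** Final bookkeeping: the variance bound replaces [t ^+ 6 / sig] by [400 * sig], and
    [sig >= t ^+ 3 / 20] absorbs the term [6 * t * n]. *)
Lemma rate_arith (R : realFieldType) (t sig n c y : R) :
  (1 <= t -> 0 < sig -> 0 <= n -> t ^+ 3 / 20 <= sig ->
   t ^+ 6 / 400 <= sig ^+ 2 -> 0 <= c ->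
   y <= sig^-1 * (t ^+ 6 * (c / t * n)) + 6 * t * n ->
   y <= sig * ((400 * c + 120) / t * n))%R.
Proof.
move=> t1 s0 n0 sigt var c0 /le_trans; apply.
have t0 : (0 < t)%R by apply: lt_le_trans t1.
have nt : (0 <= n / t)%R by rewrite divr_ge0 // ltW.
have -> : (sig * ((400 * c + 120) / t * n)
  = sig * ((400 * c) / t * n) + sig * (120 / t * n))%R by ring.
apply: lerD.
  rewrite ler_pdivrMl //.
  have -> : (sig * (sig * (400 * c / t * n)) = (400 * sig ^+ 2) * (c / t * n))%R.
    by field; rewrite gt_eqF.
  rewrite ler_wpM2r //; last lra.
  by rewrite !mulr_ge0 ?invr_ge0 // ltW.
apply: (@le_trans _ _ (t ^+ 3 / 20 * (120 / t * n))%R); last first.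
  by rewrite ler_wpM2r // !mulr_ge0 ?invr_ge0 // ltW.
have -> : (t ^+ 3 / 20 * (120 / t * n) = 6 * t * n * t)%R by field; rewrite gt_eqF.
by rewrite -[leLHS]mulr1 ler_wpM2l // !mulr_ge0 // ltW.
Qed.

(** * The Kolmogorov bound; [p], [f], [g] stand for [Phi z], [stein z], [stein_deriv z] *)

Section Stein.
Local Open Scope ring_scope.
Variables (R : realFieldType) (s : nat) (t kap : R).
Hypothesis s_gt0 : (0 < s)%N.
Local Notation S := (s%:R : R).
Hypothesis t_gt0 : 0 < t.
Hypothesis t_sqr : t ^+ 2 = S.
Hypothesis kap_root : 5 * kap * (1 - kap) = 1.
Hypothesis kap_bounds : 1 / 4 <= kap <= 3 / 10.
Local Notation tot := (@tot R s).
Local Notation N := (weight R s).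
Local Notation ssum := (@ssum R _).
Local Notation K A := (#|A|%:R : R).

Variables (sig z p : R) (f g : R -> R).
Hypothesis p_bounds : 0 <= p <= 1.
Hypothesis sig_ge0 : 0 <= sig.
Hypothesis sig_sqr : sig ^+ 2 = variance R s.
Hypothesis f_bound : forall w, `|f w| <= 3.
Hypothesis g_bound : forall w, `|g w| <= 2.
Hypothesis stein_eq : forall w, g w = w * f w + (w <= z)%R%:R - p.
Hypothesis f_lipschitz : forall w d, `|f (w + d) - f w| <= 2 * `|d|.
Hypothesis f_taylor : forall w d e, `|d| <= e -> e < `|w - z| ->
  `|f (w + d) - f w - d * g w| <= `|d| * (e * (3 + 2 * `|w|)).

(** The indicator pays for steps that may cross the corner at [z]: there the Lipschitz constant 2
    and the bound 2 on [g] add up to 4. *)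
Definition taylor_err (e w : R) : R := 4 * (`|w - z| <= e)%R%:R + e * (3 + 2 * `|w|).

Lemma taylor_err_ge0 (e w : R) : 0 <= e -> 0 <= taylor_err e w.
Proof. by move=> e0; rewrite /taylor_err addr_ge0 ?mulr_ge0 // addr_ge0 // mulr_ge0. Qed.

Lemma f_taylor_err (w d e : R) : 0 <= e -> `|d| <= e ->
  `|f (w + d) - f w - d * g w| <= e * taylor_err e w.
Proof.
move=> e0 de; apply: (@le_trans _ _ (`|d| * taylor_err e w)); last first.
  by rewrite ler_wpM2r // taylor_err_ge0.
rewrite /taylor_err; case: (boolP (`|w - z| <= e)) => h /=; last first.
  by rewrite mulr0 add0r; apply: f_taylor => //; rewrite ltNge.
apply: le_trans (ler_normB _ _) _.
have h1 := f_lipschitz w d; have h2 : `|d * g w| <= 2 * `|d|.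
  by rewrite mulrC; exact: norm_mul_le.
have h3 : 0 <= `|d| * (e * (3 + 2 * `|w|)) by rewrite !mulr_ge0 // addr_ge0 // mulr_ge0.
by rewrite mulr1 mulrDr; lra.
Qed.

Lemma move_shift_le m (A : {set 'I_m}) (x y : 'I_m) : (#|A| + m = s)%N ->
  `|move_shift R A x y| <= S.
Proof.
move=> e; rewrite /move_shift.
have [mE k0 kS m1 _] := conf_facts R s_gt0 e.
have h1 : x.+1%:R <= S by rewrite ler_nat (leq_trans (ltn_ord x)) // -e leq_addl.
have h2 : #|[set d in x |: A | (y < d)%N]|%:R <= K A + 1.
  rewrite natr1 ler_nat; apply: (@leq_trans #|x |: A|).
    by apply: subset_leq_card; apply/subsetP => d; rewrite inE => /andP[].
  by rewrite cardsU1 -add1n leq_add2r leq_b1.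
have h3 : 1 <= x.+1%:R :> R by rewrite ler1n.
have h4 := ler0n R #|[set d in x |: A | (y < d)%N]|.
by rewrite ler_norml; lra.
Qed.

Local Notation std x := ((x - mean R s) / sig).

(** Every increment of the size is at most [S], so at most [S / sig] after standardization. Swaps
    have total weight at most [S] and a further factor [|y - x| <= S], moves have total weight at
    most [S ^+ 2]; each kind yields [S ^+ 3 / sig]. *)
Lemma stein_op_near m (A : {set 'I_m}) : (#|A| + m = s)%N -> 0 < sig ->
  `|stein_op (fun x => f (std x)) A - total_var R A / sig * g (std (ssum A))|
  <= 2 * S ^+ 3 / sig * taylor_err (S / sig) (std (ssum A)).
Proof.
move=> e s0; have [mE k0 kS m1 _] := conf_facts R s_gt0 e.
have nz : sig != 0 by rewrite gt_eqF.
have S0 : 0 <= S by rewrite ler0n.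
set w := std (ssum A); set E := taylor_err _ _.
have E0 : 0 <= E by rewrite taylor_err_ge0 // divr_ge0.
have step d : `|d| <= S -> `|f (std (ssum A + d)) - f w - d / sig * g w| <= S / sig * E.
  move=> dS; have -> : std (ssum A + d) = w + d / sig by rewrite /w; field.
  apply: f_taylor_err; first by rewrite divr_ge0.
  by rewrite normrM normfV (gtr0_norm s0) ler_wpM2r // invr_ge0.
have b1 : `|swap_diff (fun x => f (std x)) A - swap_var R A / sig * g w| <= S ^+ 3 / sig * E.
  have -> : swap_diff (fun x => f (std x)) A - swap_var R A / sig * g w =
    (2 * m%:R)^-1 * \sum_(x in A) \sum_(y in ~: A) (y.+1%:R - x.+1%:R) *
      (f (std (ssum A + (y.+1%:R - x.+1%:R))) - f w - (y.+1%:R - x.+1%:R) / sig * g w).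
    rewrite /swap_diff /swap_var -!mulrA -mulrBr; congr (_ * _).
    rewrite mulr_suml -sumrB; apply: eq_bigr => x _.
    rewrite mulr_suml -sumrB; apply: eq_bigr => y _; rewrite -/w; ring.
  rewrite normrM ger0_norm; last by rewrite invr_ge0; lra.
  apply: (@le_trans _ _ ((2 * m%:R)^-1 * (K A * (m%:R - K A) * (S * (S / sig * E))))).
    rewrite -sum_pairs_const ler_wpM2l //; first by rewrite invr_ge0; lra.
    apply: le_trans (ler_norm_sum _ _ _) _; apply: ler_sum => x _.
    apply: le_trans (ler_norm_sum _ _ _) _; apply: ler_sum => y _.
    rewrite normrM; apply: ler_pM => //; first exact: (swap_shift_le _ _ _ e).
    by apply: step; exact: (swap_shift_le _ _ _ e).
  have -> : (2 * m%:R)^-1 * (K A * (m%:R - K A) * (S * (S / sig * E))) =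
    (K A * (m%:R - K A) / (2 * m%:R)) * (S ^+ 2 / sig * E).
    by field; rewrite nz gt_eqF //; lra.
  have -> : S ^+ 3 / sig * E = S * (S ^+ 2 / sig * E) by field.
  rewrite ler_wpM2r ?mulr_ge0 ?exprn_ge0 ?invr_ge0 //.
  by rewrite ler_pdivrMr; [nra | lra].
have b2 : `|move_diff (fun x => f (std x)) A / 10 - move_var R A / sig * g w|
    <= S ^+ 3 / sig * E.
  have -> : move_diff (fun x => f (std x)) A / 10 - move_var R A / sig * g w =
    10^-1 * \sum_(x in ~: A) \sum_(y in ~: (x |: A))
      (f (std (ssum A + move_shift R A x y)) - f w - move_shift R A x y / sig * g w).
    rewrite /move_diff /move_var ![_ / 10]mulrC -!mulrA -mulrBr; congr (_ * _).
    rewrite mulr_suml -sumrB; apply: eq_bigr => x _.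
    rewrite mulr_suml -sumrB; apply: eq_bigr => y _; rewrite -/w; ring.
  rewrite normrM ger0_norm; last by rewrite invr_ge0.
  apply: (@le_trans _ _ (10^-1 * ((m%:R - K A) * (m%:R - K A - 1) * (S / sig * E)))).
    rewrite ler_wpM2l ?invr_ge0 // -sum_moves_const.
    apply: le_trans (ler_norm_sum _ _ _) _; apply: ler_sum => x _.
    apply: le_trans (ler_norm_sum _ _ _) _; apply: ler_sum => y _.
    by apply: step; exact: move_shift_le.
  rewrite mulrA; have -> : S ^+ 3 / sig * E = S ^+ 2 * (S / sig * E) by field.
  rewrite ler_wpM2r ?mulr_ge0 ?invr_ge0 // mE.
  by have := sqr_ge0 S; nra.
have -> : stein_op (fun x => f (std x)) A - total_var R A / sig * g w =
  (swap_diff (fun x => f (std x)) A - swap_var R A / sig * g w) +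
  (move_diff (fun x => f (std x)) A / 10 - move_var R A / sig * g w).
  by rewrite /stein_op /total_var; ring.
apply: le_trans (ler_normD _ _) _.
have -> : 2 * S ^+ 3 / sig * E = S ^+ 3 / sig * E + S ^+ 3 / sig * E by ring.
exact: lerD.
Qed.

Lemma tot_std_norm : 0 < sig -> tot (fun m A => `|std (ssum A)|) <= N.
Proof.
move=> s0; have nz : sig != 0 by rewrite gt_eqF.
have N0 := weight_gt0 R s.
have := @tot_norm_le_sqr R s (fun m A => std (ssum A)) 1 1 ltr01.
have -> : (1 + 1) / 2 * 1 * N = N by field.
apply; rewrite expr1n !mul1r.
rewrite (eq_tot (H := fun m A => (sig ^+ 2)^-1 * (ssum A - mean R s) ^+ 2)); last first.
  by move=> m A _; field.
rewrite totZ ler_pdivrMl ?exprn_gt0 // sig_sqr /variance divfK // N_neq0 //.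
Qed.

(** Here [12252 = 2 * 26 + 2 * 6100] collects the fluctuation of [total_var] and the Taylor error,
    [400] comes from [variance_ge], and [120] from the number of parts. *)
Definition rate_const : R := 400 * 12252 + 120.

Lemma kolmogorov_bound :
  `|tot (fun m A => (ssum A <= mean R s + z * sig)%R%:R) / N - p| <= rate_const / t.
Proof.
have N0 := weight_gt0 R s; have /andP[p0 p1] := p_bounds.
(* For small [t] the claimed bound exceeds 1, and both probabilities lie between 0 and 1. *)
case: (ltP t 4200) => t1.
  have c0 : 0 <= tot (fun m A => (ssum A <= mean R s + z * sig)%R%:R) / N.
    rewrite divr_ge0 ?(ltW N0) // -(mul0r N) -tot_const.
    by apply: tot_ler => m A _.
  have c1 : tot (fun m A => (ssum A <= mean R s + z * sig)%R%:R) / N <= 1.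
    rewrite ler_pdivrMr //; apply: tot_le_const => m A _.
    by rewrite -[leRHS]/(1%:R) ler_nat leq_b1.
  apply: (@le_trans _ _ 1); first by rewrite ler_norml; lra.
  by rewrite ler_pdivlMr // /rate_const; lra.
have var := variance_ge s_gt0 t_gt0 t_sqr kap_root kap_bounds t1.
have t3 : 0 < t ^+ 3 by rewrite exprn_gt0.
have sigt : t ^+ 3 / 20 <= sig.
  rewrite -ler_sqr ?nnegrE ?divr_ge0 ?(ltW t3) // sig_sqr.
  by have -> : (t ^+ 3 / 20) ^+ 2 = t ^+ 6 / 400 by field.
have s0 : 0 < sig by apply: lt_le_trans sigt; rewrite divr_gt0.
have nz : sig != 0 by rewrite gt_eqF.
pose F x := f (std x).
pose w m (A : {set 'I_m}) := std (ssum A).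
have S0 : 0 <= S by rewrite ler0n.
(* Here [6100 = 4 * 1500 + 20 * 5]: concentration bounds the chance of being near the corner, and
   [|w|] has mean at most 1. *)
have err : tot (fun m A => taylor_err (S / sig) (w m A)) <= 6100 / t * N.
  rewrite /taylor_err totD !totZ totD tot_const totZ.
  have b1 : tot (fun m A => (`|w m A - z| <= S / sig)%R%:R) <= 1500 / t * N.
    apply: le_trans (concentration s_gt0 t_gt0 t_sqr kap_root kap_bounds (mean R s + z * sig)).
    apply: tot_ler => m A _; rewrite ler_nat.
    have -> : w m A - z = (ssum A - (mean R s + z * sig)) / sig by rewrite /w; field.
    by rewrite normrM normfV (gtr0_norm s0) ler_pM2r ?invr_gt0.
  have b2 := tot_std_norm s0; rewrite -/w in b2.
  have b3 : S / sig <= 20 / t.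
    rewrite ler_pdivrMr // -t_sqr; apply: (@le_trans _ _ (20 / t * (t ^+ 3 / 20))).
      by rewrite le_eqVlt; apply/orP; left; apply/eqP; field; rewrite gt_eqF.
    by rewrite ler_wpM2l // divr_ge0 // ltW.
  have b4 : 3 * N + 2 * tot (fun m A => `|w m A|) <= 5 * N by lra.
  have b5 : S / sig * (3 * N + 2 * tot (fun m A => `|w m A|)) <= 20 / t * (5 * N).
    apply: ler_pM => //; first by rewrite divr_ge0.
    rewrite addr_ge0 ?mulr_ge0 ?(ltW N0) //.
    by rewrite -(mul0r N) -tot_const; apply: tot_ler.
  have -> : 6100 / t * N = 4 * (1500 / t * N) + 20 / t * (5 * N) by field; rewrite gt_eqF.
  by apply: lerD => //; rewrite ler_pM2l.
(* The Stein equation replaces the indicator minus [p] by [g w - w * f w]; then [tot_stein] rewrites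
   [sig * w * f w], and [sig * g w] becomes [g w] times the variance over [sig]. *)
have main : sig * (tot (fun m A => (ssum A <= mean R s + z * sig)%R%:R) - p * N) =
    tot (fun m A => sig^-1 * (g (w m A) * (variance R s - total_var R A)))
    - tot (fun m A => stein_op F A - total_var R A / sig * g (w m A))
    - 3 / 5 * tot (fun m A => (K A - mean_card R s) * F (ssum A)).
  have := tot_stein s_gt0 F => e.
  have -> : 3 / 5 * tot (fun m A => (K A - mean_card R s) * F (ssum A)) =
     tot (fun m A => (ssum A - mean R s) * F (ssum A)) - tot (fun m A => stein_op F A).
    by rewrite e; ring.
  rewrite -tot_const -totB -totZ -!totB; apply: eq_tot => m A _.
  have -> : (ssum A <= mean R s + z * sig) = (w m A <= z).
    by rewrite /w ler_pdivrMr // lerBlDl.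
  rewrite -sig_sqr /F -/(w m A).
  have -> : (w m A <= z)%R%:R = g (w m A) - w m A * f (w m A) + p by rewrite stein_eq; ring.
  by rewrite {2}/w; field.
have m1 : `|tot (fun m A => sig^-1 * (g (w m A) * (variance R s - total_var R A)))|
    <= sig^-1 * (2 * (26 * t ^+ 5 * N)).
  rewrite totZ normrM ger0_norm ?invr_ge0 // ler_wpM2l ?invr_ge0 //.
  apply: le_trans (tot_norm _ _) _.
  apply: le_trans (ler_wpM2l _ (tot_total_var_variance s_gt0 t_gt0 t_sqr kap_root kap_bounds)) => //.
  by rewrite -totZ; apply: tot_ler => m A _; rewrite [X in 2 * X]distrC; exact: norm_mul_le.
have m2 : `|tot (fun m A => stein_op F A - total_var R A / sig * g (w m A))|
    <= 2 * S ^+ 3 / sig * (6100 / t * N).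
  apply: le_trans (tot_norm _ _) _.
  apply: le_trans (ler_wpM2l _ err); last by rewrite !mulr_ge0 ?exprn_ge0 ?invr_ge0.
  by rewrite -totZ; apply: tot_ler => m A e; exact: stein_op_near.
have m3 : `|3 / 5 * tot (fun m A => (K A - mean_card R s) * F (ssum A))|
    <= 2 * (3 * t * N).
  rewrite normrM ger0_norm ?divr_ge0 //.
  have -> : 2 * (3 * t * N) = 3 / 5 * (10 / 3 * (3 * t * N)) by field.
  rewrite ler_wpM2l ?divr_ge0 //.
  apply: (@le_trans _ _ (3 * (3 * t * N))); last first.
    by rewrite ler_wpM2r ?mulr_ge0 ?(ltW N0) ?(ltW t_gt0) // ler_pdivlMr // -!natrM ler_nat.
  apply: le_trans (tot_norm _ _) _.
  apply: le_trans (ler_wpM2l _ (tot_mean_card_norm s_gt0 t_gt0 t_sqr kap_root kap_bounds)) => //.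
  by rewrite -totZ; apply: tot_ler => m A _; rewrite mulrC; exact: norm_mul_le (f_bound _).
set P := tot _ in main *.
have total : sig * `|P - p * N| <= sig^-1 * (2 * (26 * t ^+ 5 * N)) +
    2 * S ^+ 3 / sig * (6100 / t * N) + 2 * (3 * t * N).
  rewrite -{1}(gtr0_norm s0) -normrM main.
  apply: le_trans (ler_normB _ _) _; apply: lerD m3.
  by apply: le_trans (ler_normB _ _) _; exact: lerD.
have total2 := rate_arith (t_ge1 s_gt0 t_gt0 t_sqr) s0 (ltW N0) sigt.
rewrite sig_sqr in total2; move/(_ _ _ var): total2 => total2.
have {}total2 : sig * `|P - p * N| <= sig * (rate_const / t * N).
  apply: total2; first exact: ler0n.
  apply: le_trans total _; rewrite le_eqVlt; apply/orP; left; apply/eqP.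
  by rewrite -t_sqr; field; rewrite nz gt_eqF.
rewrite -(ler_pM2r N0) -(ler_pM2l s0); apply: le_trans total2.
by rewrite -[X in _ * (_ * X)](gtr0_norm N0) -normrM mulrBl divfK ?N_neq0.
Qed.

End Stein.

(** * Cores with distinct parts as subsets of an initial segment *)

Section Cores.
Local Open Scope nat_scope.

Lemma gtn_trans : transitive gtn.
Proof. by move=> x y z /= ? ?; lia. Qed.

(* Along the first row the hook length drops by one or two at each step, from
   [head 0 l + size l - 1] to [1], so it cannot jump over both [s] and [s + 1]. *)
Lemma core_distinctP (s : nat) (l : seq nat) : 0 < s ->
  core_distinct s l <->
  [/\ sorted gtn l, all (leq 1) l & head 0 l + size l <= s].
Proof.
move=> s0; split.
  case=> -[_ pos] [dis [cs cs1]]; split => //.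
  case: l pos dis cs cs1 => [//|a l] /= /andP[a0 pos] dis cs cs1.
  rewrite leqNgt; apply/negP => lt.
  have alt : all (gtn a) l by exact: order_path_min gtn_trans dis.
  have ul : uniq l.
    apply: (sorted_uniq gtn_trans) (path_sorted dis) => x /=; exact: ltnn.
  pose h j := (a - j - 1) + count (leq j.+1) l + 1.
  have hj j : j < a -> h j != s /\ h j != s.+1.
    move=> ja; split; apply/eqP.
      by have := cs 0 j isT ja; rewrite /hook /= drop0.
    by have := cs1 0 j isT ja; rewrite /hook /= drop0.
  (* Initially [h 0 = a + size l] is at least [s] and differs from [s] and [s + 1]. A drop of at
     most two from [s + 2] or more would have to land on one of these, so [h] stays above them,
     against [h (a - 1) = 1]. *)
  have big j : j < a -> s.+2 <= h j.
    elim: j => [|j IH] ja.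
      have [/eqP h1 /eqP h2] := hj 0 ja; move: h1 h2; rewrite /h.
      by move: pos; rewrite all_count => /eqP ->; lia.
    have [/eqP h1 /eqP h2] := hj _ ja; have {IH} := IH (ltnW ja).
    suff : h j <= (h j.+1).+2 by lia.
    have -> : h j = (a - j - 1) + (count (leq j.+2) l + count_mem j.+1 l) + 1.
      rewrite /h -count_predUI (@eq_count _ (predI _ _) pred0) ?count_pred0 ?addn0.
        by congr (_ + _ + _); apply: eq_count => x /=; rewrite leq_eqVlt orbC eq_sym.
      by move=> x /=; lia.
    have : count_mem j.+1 l <= 1 by rewrite count_uniq_mem // leq_b1.
    by rewrite /h; lia.
  have := big a.-1; rewrite /h (@eq_in_count _ _ pred0) ?count_pred0; first by lia.
  by move=> x /(allP alt) /=; lia.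
case=> dis pos le.
(* All hook lengths are at most [head 0 l + size l - 1], hence below [s]. *)
have core t : s <= t -> is_core t l.
  move=> st i j il jl; rewrite /hook.
  have c1 := count_size (fun a => j < a) (drop i.+1 l); rewrite size_drop in c1.
  set c := count _ _ in c1 *.
  have : nth 0 l i <= head 0 l.
    case: l {pos le c c1} dis il jl => [//|a l] /= dis; case: i => [//|i] /= il _.
    have /allP h := order_path_min gtn_trans dis.
    by have := h _ (mem_nth 0 il) => /=; lia.
  by lia.
split; first by split => //; apply: sub_sorted dis => x y /=; lia.
by split=> //; split; apply: core.
Qed.

(** Reversed because [enum] is increasing, whereas partitions list their parts in decreasing
    order. *)
Definition parts m (A : {set 'I_m}) : seq nat := rev [seq i.+1 | i : 'I_m <- enum A].

Lemma size_parts m (A : {set 'I_m}) : size (parts A) = #|A|.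
Proof. by rewrite size_rev size_map cardE. Qed.

Lemma mem_parts m (A : {set 'I_m}) (x : nat) :
  (x \in parts A) = [exists i in A, x == i.+1].
Proof.
rewrite mem_rev; apply/mapP/exists_inP => [[i]|[i iA /eqP ->]].
  by rewrite mem_enum => iA ->; exists i.
by exists i; rewrite ?mem_enum.
Qed.

Lemma parts_inj m : injective (@parts m).
Proof.
move=> A B e; apply/setP => i.
have mem (C : {set 'I_m}) : (i.+1 \in parts C) = (i \in C).
  rewrite mem_parts; apply/exists_inP/idP => [[j jC /eqP[/val_inj ->]] //|iC].
  by exists i.
by rewrite -!mem e.
Qed.

Lemma sorted_parts m (A : {set 'I_m}) : sorted gtn (parts A).
Proof.
rewrite rev_sorted sorted_map /enum_mem; apply: sorted_filter.
  by move=> x y z /=; exact: ltn_trans.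
have := iota_ltn_sorted 0 m; rewrite -val_enum_ord sorted_map enumT.
by apply: sub_sorted => x y.
Qed.

Lemma psize_parts m (A : {set 'I_m}) : psize (parts A) = \sum_(i in A) i.+1.
Proof. by rewrite /psize sumn_rev sumnE big_map big_enum. Qed.

Definition core_list (s : nat) : seq (seq nat) :=
  [seq parts A | k <- iota 0 s.+1, A <- enum [set A : {set 'I_(s - k)} | #|A| == k]].

(** The number of parts determines [k], and for a fixed ground set the parts determine [A]. *)
Lemma uniq_core_list s : uniq (core_list s).
Proof.
apply: allpairs_uniq_dep => [||[k A] [k' A']].
- exact: iota_uniq.
- by move=> k _; exact: enum_uniq.
have cardE u : u \in [seq Tagged (fun i => {set 'I_(s - i)}) A
    | k <- iota 0 s.+1, A <- enum [set A : {set 'I_(s - k)} | #|A| == k]] ->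
    #|tagged u| = tag u.
  by case/allpairsPdep => i [B [_]]; rewrite mem_enum inE => /eqP Bi ->.
move=> /cardE /= Ak /cardE /= Ak' e.
have ek : k = k' by rewrite -Ak -Ak' -!size_parts e.
by move: A' {Ak'} e; rewrite -ek => A' /parts_inj ->.
Qed.

Lemma mem_core_list s p : 0 < s -> p \in core_list s <-> core_distinct s p.
Proof.
move=> s0; rewrite core_distinctP //; split.
  case/allpairsPdep => k [A [ks]]; rewrite mem_enum inE => /eqP Ak ->; split.
  - exact: sorted_parts.
  - by apply/allP => x; rewrite mem_parts => /exists_inP[i _ /eqP ->].
  rewrite size_parts Ak; move: ks; rewrite mem_iota add0n ltnS => /andP[_ ks].
  case e : (parts A) => [|x q] //=.
  have : x \in parts A by rewrite e mem_head.
  by rewrite mem_parts => /exists_inP[i _ /eqP ->]; have := ltn_ord i; lia.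
case=> dis pos le; apply/allpairsPdep; set k := size p in le.
exists k, [set i : 'I_(s - k) | i.+1 \in p].
have e : parts [set i : 'I_(s - k) | i.+1 \in p] = p.
  apply: (irr_sorted_eq gtn_trans) => //; first by move=> x /=; rewrite ltnn.
    exact: sorted_parts.
  move=> x; rewrite mem_parts; apply/exists_inP/idP => [[i]|xp].
    by rewrite inE => ip /eqP ->.
  have x0 := allP pos _ xp.
  have xh : x <= head 0 p.
    case: (p) xp dis => [//|a q] /=; rewrite inE => /orP[/eqP -> //|xq] dis.
    by have /allP h := order_path_min gtn_trans dis; have := h _ xq => /=; lia.
  (* Every part is at most the largest one, which is at most [s - k]; so its predecessor is an index
     in the ground set. *)
  have xs : x.-1 < s - k by lia.
  by exists (Ordinal xs); rewrite ?inE /= prednK.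
split => //.
  by rewrite mem_iota; lia.
by rewrite mem_enum inE -size_parts e.
Qed.

Lemma core_list_sum (R : nmodType) (s : nat) (L : seq (seq nat)) (G : nat -> R) :
  0 < s -> uniq L -> (forall p, p \in L <-> core_distinct s p) ->
  (\sum_(p <- L) G (psize p) =
   \sum_(k < s.+1) \sum_(A : {set 'I_(s - k)} | #|A| == k)
     G (\sum_(i in A) i.+1)%N)%R.
Proof.
move=> s0 uL memL; rewrite (perm_big (core_list s)); last first.
  apply: uniq_perm => //; first exact: uniq_core_list.
  move=> p; have [cl lc] := mem_core_list p s0; have [Ll lL] := memL p.
  by apply/idP/idP => h; [exact: lc (Ll h) | exact: lL (cl h)].
rewrite big_allpairs_dep -[iota 0 s.+1]/(index_iota 0 s.+1) big_mkord.
apply: eq_bigr => k _; rewrite big_enum /=.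
by apply: eq_big => A; rewrite ?inE // psize_parts.
Qed.

End Cores.

(** * Mean, variance and distribution function of a list of cores as sums over subsets *)

Section Transfer.
Local Open Scope ring_scope.
Variables (s : nat) (L : seq (seq nat)).
Hypothesis s_gt0 : (0 < s)%N.
Hypothesis uniq_L : uniq L.
Hypothesis mem_L : forall p : seq nat, p \in L <-> core_distinct s p.
Local Notation R := Rdefinitions.R.

Lemma sum_psize (G : R -> R) :
  \big[Rplus/R0]_(p <- L) G (INR (psize p)) = tot s (fun m A => G (ssum R A)).
Proof.
rewrite -[LHS]/(\sum_(p <- L) G (INR (psize p))).
rewrite (core_list_sum (fun n => G (INR n)) s_gt0 uniq_L mem_L).
apply: eq_bigr => k _; apply: eq_bigr => A _; congr G.
by rewrite INRE /ssum natr_sum.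
Qed.

Lemma size_weight : INR (size L) = weight R s.
Proof.
by rewrite INRE -sum1_size natr_sum; exact: (sum_psize (fun _ => 1)).
Qed.

Lemma unif_mean_tot : unif_mean L = mean R s.
Proof. by rewrite /unif_mean RdivE size_weight (sum_psize id). Qed.

Lemma unif_var_tot : unif_var L = variance R s.
Proof.
rewrite /unif_var RdivE size_weight unif_mean_tot.
rewrite (sum_psize (fun x => pow (Rminus x (mean R s)) 2)); congr (_ / _).
by apply: eq_tot => m A _; rewrite RpowE RminusE.
Qed.

Lemma unif_cdf_tot (y : R) :
  unif_cdf L y = tot s (fun m A => (ssum R A <= y)%R%:R) / weight R s.
Proof.
rewrite /unif_cdf RdivE size_weight; congr (_ / _).
rewrite INRE -sum1_count natr_sum big_mkcond /= -(sum_psize (fun x => (x <= y)%R%:R)).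
apply: eq_bigr => p _; case: Rle_dec => [/RleP -> | /RleP /negPf ->] //.
Qed.

Lemma variance_ge0 : 0 <= variance R s.
Proof.
rewrite divr_ge0 ?(ltW (weight_gt0 _ _)) // -(mul0r (weight R s)) -tot_const.
by apply: tot_ler => m A _; exact: sqr_ge0.
Qed.

End Transfer.

(** * Instantiation over the real numbers *)

Lemma natrIZR (n : nat) : (n%:R%R : R) = IZR (BinInt.Z.of_nat n).
Proof. by rewrite -INRE INR_IZR_INZ. Qed.

Open Scope R_scope.

Lemma sqrt5_bounds : 2 <= sqrt 5 <= 5 / 2.
Proof.
split; [rewrite -{1}(sqrt_pow2 2); last Lra.lra | rewrite -(sqrt_pow2 (5 / 2)); last Lra.lra].
  by apply: sqrt_le_1; Lra.lra.
by apply: sqrt_le_1; Lra.lra.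
Qed.

Theorem theorem1 :
  exists C1 : R,
    forall (s : nat), (0 < s)%N ->
    forall L : seq (seq nat),
      uniq L ->
      (forall p : seq nat, p \in L <-> core_distinct s p) ->
      forall x : R,
        Rabs (unif_cdf L (unif_mean L + x * unif_sd L) - Phi x)
          <= C1 / sqrt (INR s).
Proof.
exists (rate_const R) => s s0 L uL memL x.
have S0 : 0 < INR s by apply: lt_0_INR; apply/ssrnat.ltP.
have t0 : 0 < sqrt (INR s) by exact: sqrt_lt_R0.
(* The smaller root of [5 * x * (1 - x) = 1]; the bounds on [sqrt 5] place it between [1 / 4] and
   [3 / 10]. *)
pose kap := (5 - sqrt 5) / 10.
have [q1 q2] := sqrt5_bounds.
have kap_root : 5 * kap * (1 - kap) = 1.
  have q : sqrt 5 * sqrt 5 = 5 by apply: sqrt_sqrt; Lra.lra.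
  by rewrite /kap; Lra.nra.
have kap_bounds : 1 / 4 <= kap <= 3 / 10 by rewrite /kap; Lra.lra.
rewrite /unif_sd (unif_var_tot s0 uL memL) (unif_mean_tot s0 uL memL)
  (unif_cdf_tot s0 uL memL).
have /RleP v0 := variance_ge0 s.
apply/RleP.
apply: (@kolmogorov_bound R s _ kap s0 _ _ _ _ _ x (Phi x) (stein x) (stein_deriv x)).
- by apply/RltP.
- by rewrite expr2 -INRE; apply: sqrt_sqrt; left.
- by rewrite natrIZR.
- by case: kap_bounds => k1 k2; apply/andP; split; apply/RleP; rewrite !natrIZR.
- by apply/andP; split; apply/RleP; [exact: Phi_ge0 | exact: Phi_le1].
- by apply/RleP; exact: sqrt_pos.
- by rewrite expr2; exact: sqrt_sqrt.
- by move=> w; apply/RleP; rewrite natrIZR; case: (stein_bounds x w).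
- by move=> w; apply/RleP; rewrite natrIZR; case: (stein_bounds x w).
- by move=> w; rewrite /stein_deriv; case: Rle_dec => h /=;
     move: h => /RleP; [move=> -> | move=> /negPf ->].
- by move=> w d; apply/RleP; rewrite natrIZR; exact: stein_lipschitz.
- move=> w d e /RleP de /RltP ez; apply/RleP; rewrite !natrIZR; exact: stein_taylor.
Qed.
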